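(* Consider the following theorem, in which $k$ is any positive integer: if $(\Phi,M^n)$ is a smooth $(\mathbb{Z}_2)^k$-action on a closed smooth $n$-dimensional manifold such that each $p$-dimensional part $F^p$ of the fixed point set $F$ possesses the linear independence property, $w(F)=1$, and $\dim M^n>2^k\dim F$, then $(\Phi,M^n)$ bounds equivariantly. In this theorem, the condition that each part $F^p$ of the fixed point set $F$ possesses the linear independence property is necessary (that is, the theorem does not remain true if this condition is omitted).
   Context: Put $G=(\mathbb{Z}_2)^k$. The fixed point set $F$ of a smooth $G$-action on a closed smooth manifold is a disjoint union of closed submanifolds, possibly of different dimensions; $\dim F$ is the largest dimension of a component, and $F^p$ is the union of the $p$-dimensional components. $w(F)=1$ means that for every connected component $C$ of $F$ all Stiefel-Whitney classes of the tangent bundle of $C$ vanish in positive dimension. ''Bounds equivariantly'' means that the $G$-manifold is equivariantly diffeomorphic to the boundary of a compact smooth $G$-manifold. Linear independence property: let $\mathrm{Hom}(G,\mathbb{Z}_2)$ be the set of homomorphisms $\rho:G\to\{\pm1\}$, with trivial element $\rho_0$, and let $\alpha_\rho\in H^1(BG;\mathbb{Z}_2)\subset H^*(BG;\mathbb{Z}_2)=\mathbb{Z}_2[a_1,\dots,a_k]$ (each $a_i$ of degree one) be the degree-one polynomial corresponding to $\rho$ under $H^1(BG;\mathbb{Z}_2)\cong\mathrm{Hom}(G,\mathbb{Z}_2)$. For a connected component $C$ of $F$, the normal bundle of $C$ in $M$ splits as $\bigoplus_{\rho\neq\rho_0}\nu_{C,\rho}$ with $G$ acting in the fibers of $\nu_{C,\rho}$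 via $\rho$; put $q_{C,\rho}=\dim\nu_{C,\rho}$, and call $\{q_{C,\rho}\}$ the normal dimensional sequence of $C$. Without changing the action up to equivariant cobordism, form the connected sum of those components of $F^p$ with the same normal dimensional sequence if $p>0$, and cancel pairs of points with the same normal dimensional sequence if $p=0$; the result ${F'}^p$ has components with distinct normal dimensional sequences (and ${F'}^0$ may be empty). $F^p$ possesses the linear independence property if the monomials $1/\prod_{\rho\neq\rho_0}\alpha_\rho^{q_{C,\rho}}$, one for each connected component $C$ of ${F'}^p$, are linearly independent over $\mathbb{Z}_2$ in the quotient field of $\mathbb{Z}_2[a_1,\dots,a_k]$ (for $p=0$, the property also holds if ${F'}^0$ is empty). *)

(* Defs.v *)
From HB Require Import structures.
From mathcomp Require Import all_boot all_order all_algebra.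
From mathcomp Require Import all_classical all_reals all_analysis.
Import Order.TTheory GRing.Theory Num.Theory.
Import numFieldNormedType.Exports.
Set Implicit Arguments.
Unset Strict Implicit.
Unset Printing Implicit Defensive.
Local Open Scope classical_set_scope.
Local Open Scope ring_scope.

(** * Smooth functions on subsets of R^n *)

Section Smooth.
Variable R : realType.

(* [U] is meant to be open. *)
Fixpoint Ck n (r : nat) (U : set 'rV[R]_n) (f : 'rV[R]_n -> R) : Prop :=
  (forall x, U x -> {for x, continuous f}) /\
  if r is r'.+1 then
    forall i : 'I_n,
      (forall x, U x -> derivable f x (delta_mx 0 i)) /\
      Ck r' U (fun x => 'D_(delta_mx 0 i) f x)
  else True.

(* On an arbitrary subset, smooth means: locally the restriction of a smooth
   function defined on an open subset of R^n. *)
Definition smooth_on n (A : set 'rV[R]_n) (f : 'rV[R]_n -> R) : Prop :=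
  forall x, A x -> exists U : set 'rV[R]_n, exists g : 'rV[R]_n -> R,
    [/\ open U, U x, (forall r, Ck r U g)
      & forall y, (A `&` U) y -> f y = g y].

Definition smooth_on_vec m n (A : set 'rV[R]_m) (f : 'rV[R]_m -> 'rV[R]_n) :=
  forall j : 'I_n, smooth_on A (fun x => f x 0 j).

(** * Compact smooth manifolds modelled on a subset H of R^n *)

Section Manifold.
Variable n : nat.

Record chart (X : topologicalType) := Chart {
  cdom : set X;
  cmap : X -> 'rV[R]_n;
  cinv : 'rV[R]_n -> X }.

Definition is_chart (H : set 'rV[R]_n) (X : topologicalType) (c : chart X) :=
  [/\ open (cdom c),
      exists2 O : set 'rV[R]_n, open O & cmap c @` cdom c = O `&` H,
      forall x, cdom c x -> cinv c (cmap c x) = x,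
      {within cdom c, continuous (cmap c)}
    & {within cmap c @` cdom c, continuous (cinv c)}].

Definition smooth_transition (X : topologicalType) (c d : chart X) :=
  smooth_on_vec (cmap c @` (cdom c `&` cdom d)) (cmap d \o cinv c).

(* The atlas need not be maximal.  Second countability follows from
   compactness. *)
Record compact_manifold (H : set 'rV[R]_n) := CompactManifold {
  mcarrier :> topologicalType;
  atlas : set (chart mcarrier);
  mhausdorff : hausdorff_space mcarrier;
  mcompact : compact [set: mcarrier];
  atlas_chart : forall c, atlas c -> is_chart H c;
  atlas_cover : forall x : mcarrier, exists2 c, atlas c & cdom c x;
  atlas_smooth : forall c d, atlas c -> atlas d -> smooth_transition c d }.

Arguments atlas {H} _ _.

Definition compatible (H : set 'rV[R]_n) (M : compact_manifold H)
    (c : chart M) :=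
  is_chart H c /\
  forall d, atlas M d -> smooth_transition c d /\ smooth_transition d c.

(* smooth real-valued functions on a subset of a manifold *)
Definition smooth_fun (H : set 'rV[R]_n) (M : compact_manifold H)
    (A : set M) (f : M -> R) :=
  forall c, atlas M c -> smooth_on (cmap c @` (cdom c `&` A)) (f \o cinv c).

End Manifold.

Arguments atlas {n H} _ _.

Definition closed_manifold (n : nat) := compact_manifold [set: 'rV[R]_n].

Definition half_space (n : nat) : set 'rV[R]_n.+1 := [set v | 0 <= v 0 ord0].
Arguments half_space : clear implicits.

Definition manifold_with_boundary (n : nat) := compact_manifold (half_space n).

(* By invariance of the boundary, the choice of the chart is irrelevant. *)
Definition boundary n (W : manifold_with_boundary n) : set W :=
  [set x | exists c, [/\ atlas W c, cdom c x & cmap c x 0 ord0 = 0]].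

(* smooth maps defined on a subset [A] of [M] *)
Definition smooth_map m n (H : set 'rV[R]_m) (K : set 'rV[R]_n)
    (M : compact_manifold H) (N : compact_manifold K)
    (A : set M) (f : M -> N) :=
  {within A, continuous f} /\
  forall c d, atlas M c -> atlas N d ->
    smooth_on_vec (cmap c @` (A `&` cdom c `&` f @^-1` cdom d))
      (cmap d \o f \o cinv c).

(* [S] is an embedded [p]-dimensional submanifold of [M]. *)
Definition submanifold n (M : closed_manifold n) (p : nat) (S : set M) :=
  (p <= n)%N /\
  forall x, S x -> exists c : chart n M,
    [/\ compatible c, cdom c x
      & cmap c @` (cdom c `&` S) =
        cmap c @` cdom c `&`
          [set v | forall j : 'I_n, (p <= j)%N -> v 0 j = 0]].

(** * Smooth actions of (Z_2)^k *)

Record smooth_action (k n : nat) (H : set 'rV[R]_n)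
    (M : compact_manifold H) := SmoothAction {
  act :> 'rV['F_2]_k -> M -> M;
  act0 : forall x, act 0 x = x;
  actD : forall g h x, act (g + h) x = act g (act h x);
  act_smooth : forall g, smooth_map setT (act g) }.

Definition fixed_set k n (M : closed_manifold n) (a : smooth_action k M) :
    set M := [set x | forall g, a g x = x].

Definition fixed_component k n (M : closed_manifold n)
    (a : smooth_action k M) (C : set M) :=
  exists2 x, fixed_set a x & C = connected_component (fixed_set a) x.

(* [d] is the largest dimension of a component of the fixed point set; there is
   no such [d] when there are no fixed points (dim F = -oo). *)
Definition fixed_dim k n (M : closed_manifold n) (a : smooth_action k M)
    (d : nat) :=
  (exists2 C, fixed_component a C & submanifold d C) /\
  forall C p, fixed_component a C -> submanifold p C -> (p <= d)%N.

(* [f] is an equivariant diffeomorphism, with inverse [g], from [M] onto the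
   boundary of [W]. *)
Definition bounds_equivariantly k n (M : closed_manifold n)
    (a : smooth_action k M) :=
  exists (W : manifold_with_boundary n) (b : smooth_action k W)
         (f : M -> W) (g : W -> M),
    [/\ smooth_map setT f /\ smooth_map (@boundary n W) g,
        forall x, boundary (f x),
        forall x, g (f x) = x,
        forall y, boundary y -> f (g y) = y
      & forall h x, f (a h x) = b h (f x)].

(** * Singular cohomology with coefficients in Z_2 *)

Definition stdsimplex q : set 'rV[R]_q.+1 :=
  [set t | (forall i, 0 <= t 0 i) /\ \sum_i t 0 i = 1].
Arguments stdsimplex : clear implicits.

(* The affine map between standard simplices induced by a map of vertices. *)
Definition vmap_fun p q (th : 'I_p.+1 -> 'I_q.+1) (t : 'rV[R]_p.+1) :
    'rV[R]_q.+1 := \row_j \sum_(i | th i == j) t 0 i.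

Lemma vmap_subproof p q (th : 'I_p.+1 -> 'I_q.+1) (t : stdsimplex p) :
  vmap_fun th (set_val t) \in stdsimplex q.
Proof.
have /set_mem [t0 t1] := valP t; apply/mem_set; split.
  by move=> j; rewrite mxE; apply: sumr_ge0 => i _.
under eq_bigr do rewrite mxE.
by rewrite -t1 [RHS](partition_big th xpredT).
Qed.

Definition vmap p q (th : 'I_p.+1 -> 'I_q.+1) (t : stdsimplex p) :
  stdsimplex q := exist _ (vmap_fun th (set_val t)) (vmap_subproof th t).

Section Cohomology.
Variable X : topologicalType.

(* the singular simplices of a subspace [A] of [X] *)
Definition simplices (A : set X) q : set (stdsimplex q -> X) :=
  [set s | continuous s /\ forall t, A (s t)].

(* The values of a cochain on discontinuous maps are never used. *)
Definition cochain q := (stdsimplex q -> X) -> 'F_2.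

Definition codiff q (c : cochain q) : cochain q.+1 :=
  fun s => \sum_(i < q.+2) c (s \o vmap (lift i)).

(* relative cocycles and coboundaries of the pair (A, B) *)
Definition cocycle (A B : set X) q (c : cochain q) :=
  (forall s, simplices A s -> codiff c s = 0) /\
  (forall s, simplices B s -> c s = 0).

Definition coboundary (A B : set X) q : cochain q -> Prop :=
  match q with
  | 0%N => fun c => forall s, simplices A s -> c s = 0
  | _.+1 => fun c => exists b : cochain _,
      (forall s, simplices B s -> b s = 0) /\
      (forall s, simplices A s -> c s = codiff b s)
  end.

Definition cohomologous (A B : set X) q (c c' : cochain q) :=
  coboundary A B (fun s => c s - c' s).

Definition cup p q (a : cochain p) (b : cochain q) : cochain (p + q) :=
  fun s => a (s \o vmap (fun i : 'I_p.+1 => inord i)) *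
           b (s \o vmap (fun j : 'I_q.+1 => inord (p + j))).

(* A set N = {n_0 < ... < n_r} of vertices cuts the vertices 0, ..., m into the
   consecutive overlapping blocks [0, n_0], [n_0, n_1], ..., [n_r, m]; this is
   the union of the blocks whose index has the parity of [b]. *)
Definition blocks m (N : {set 'I_m.+1}) (b : bool) : {set 'I_m.+1} :=
  [set v | (v \in N) || (odd #|[set x in N | (x < v)%N]| == b)].

Definition vertices m (A : {set 'I_m.+1}) p (i : 'I_p.+1) : 'I_m.+1 :=
  nth ord0 (enum A) i.
Arguments vertices {m} A {p} i.

(* The Steenrod square Sq^i(u) = u \cup_(p - i) u, by Steenrod's cochain formula
   for the cup-i products; the sum is empty when i > p. *)
Definition Sq p i (u : cochain p) : cochain (i + p) :=
  fun s => \sum_(N : {set 'I_(i + p).+1} |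
                  (#|N| + i == p.+1)%N && (#|blocks N false| == p.+1)%N)
    u (s \o vmap (vertices (blocks N false))) *
    u (s \o vmap (vertices (blocks N true))).
Arguments Sq {p} i u _.

End Cohomology.
Arguments Sq {X p} i u _.

(** * Stiefel-Whitney classes of the tangent bundle of a submanifold *)

Section StiefelWhitney.
Variables (n : nat) (M : closed_manifold n).

(* The derivations at [x] of the algebra of smooth functions on [S], extended
   by 0 to the functions that are not smooth on [S]. *)
Definition tangent_vector (S : set M) (x : M) (D : (M -> R) -> R) :=
  [/\ forall f, ~ smooth_fun S f -> D f = 0,
      forall (r : R) f g, smooth_fun S f -> smooth_fun S g ->
        D (fun y => r * f y + g y) = r * D f + D g
    & forall f g, smooth_fun S f -> smooth_fun S g ->
        D (fun y => f y * g y) = f x * D g + D f * g x].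

(* The tangent bundle of [S] is topologized as a subspace of this product: its
   topology is the coarsest one for which the projection and the differentials
   of all the smooth functions on [S] are continuous. *)
Definition tangent_ambient : topologicalType := (M * {ptws (M -> R) -> R})%type.

Definition tangent_bundle (S : set M) : set tangent_ambient :=
  [set e | S e.1 /\ tangent_vector S e.1 e.2].

Definition nonzero_vectors : set tangent_ambient :=
  [set e | e.2 <> (fun=> 0)].

Definition fiber (x : M) : set tangent_ambient := [set e | e.1 = x].

(* [u] represents the mod 2 Thom class of the tangent bundle E of [S]: its
   restriction to each (E_x, E_x \ 0) is nonzero. *)
Definition thom_class (S : set M) p (u : cochain tangent_ambient p) :=
  let E := tangent_bundle S in let E0 := E `&` nonzero_vectors in
  cocycle E E0 u /\
  forall x, S x -> ~ coboundary (E `&` fiber x) (E0 `&` fiber x) u.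

(* [w] represents the [i]-th Stiefel-Whitney class of the tangent bundle
   pi : E -> S of a [p]-dimensional [S], i.e. the class corresponding to Sq^i(u)
   under the Thom isomorphism x |-> pi^*(x) \cup u. *)
Definition stiefel_whitney (S : set M) (p i : nat) (w : cochain M i) :=
  let E := tangent_bundle S in let E0 := E `&` nonzero_vectors in
  cocycle S set0 w /\
  exists2 u : cochain tangent_ambient p, thom_class S u
    & cohomologous E E0 (cup (fun s => w (fst \o s)) u) (Sq i u).

End StiefelWhitney.

(* w(F) = 1 : the zero class is the i-th Stiefel-Whitney class of every
   component of F, for all i > 0. *)
Definition fixed_SW_trivial k n (M : closed_manifold n)
    (a : smooth_action k M) :=
  forall C p, fixed_component a C -> submanifold p C ->
  forall i, (0 < i)%N -> @stiefel_whitney n M C p i (fun=> 0).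

End Smooth.

(* Main.v *)
Require Import Defs.
From HB Require Import structures.
From mathcomp Require Import all_boot all_order all_algebra.
From mathcomp Require Import all_classical all_reals all_analysis.
From mathcomp Require Import ring lra.
Import Order.TTheory GRing.Theory Num.Theory.
Import numFieldNormedType.Exports.
Set Implicit Arguments.
Unset Strict Implicit.
Unset Printing Implicit Defensive.
Local Open Scope classical_set_scope.
Local Open Scope ring_scope.

(** The counterexample is the real projective plane, on which the group [(Z_2)^3]
    acts by sign changes of the homogeneous coordinates.  Its fixed points are the
    three coordinate lines.  Hence the fixed point set has dimension 0, its
    Stiefel-Whitney classes vanish in positive degree, and [2 > 2 ^ 3 * 0].  The
    linear independence property fails: the characters at the [i]-th point are the
    [a_i + a_l] with [l != i], and the sum of the three fractions
    [1 / ((a_i + a_l) (a_i + a_m))] is 0.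

    This action does not bound because it has an odd number of isolated fixed
    points (lemma [even_fixed_points]).  Suppose that a closed manifold with
    finitely many fixed points, none of which has a nonzero fixed tangent vector,
    is the boundary of a [(Z_2)^k]-manifold [W].  Near a fixed point of [W], the
    action is conjugate to its derivative (the averaging trick, [linearize]), so
    that its fixed points form a submanifold whose dimension is the rank of the
    projection [avg L] onto the fixed vectors.  This dimension is locally constant
    on the fixed point set, because a trace is continuous; therefore the part
    [curve_part] of dimension 1 is compact.  At a boundary point, the fixed vectors
    form a line that points inwards ([boundary_line]).  So [curve_part] is a compact
    curve with boundary ([fixed_arc]), and its boundary consists of the fixed points
    of the closed manifold.  But a compact curve has an even number of boundary
    points ([even_boundary]).

    The local study needs no more of smoothness than strict differentiability
    ([sd]), a property that passes to subsets such as a half-space or its boundary.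
    The parity of the boundary is Stokes' theorem modulo 2, where indicator
    functions of finite unions of arcs replace smooth functions, so that no
    orientation is needed. *)

(** * Strict derivatives *)

Section StrictDerivative.
Variable R : realType.

Lemma norm_entry n (v : 'rV[R]_n) i : `|v 0 i| <= `|v|.
Proof.
rewrite [leRHS]/Num.norm/= mx_normrE.
by apply/bigmax_geP; right => /=; exists (0, i).
Qed.

Lemma row_neq0 n (v : 'rV[R]_n) : v != 0 -> exists i, v 0 i != 0.
Proof.
move=> v0; apply: contrapT => /forallNP N; move/eqP: v0; apply; apply/rowP => j.
by rewrite [RHS]mxE; apply/eqP; have := N j; case: eqVneq.
Qed.

Lemma norm_row_le n (v : 'rV[R]_n) r :
  0 <= r -> (forall i, `|v 0 i| <= r) -> `|v| <= r.
Proof.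
move=> r0 vr; rewrite [leLHS]/Num.norm/= mx_normrE.
by apply/bigmax_leP; split => // -[i j] _ /=; rewrite (ord1 i).
Qed.

Lemma norm_row_lt n (v : 'rV[R]_n) r :
  0 < r -> (forall i, `|v 0 i| < r) -> `|v| < r.
Proof.
move=> r0 vr; rewrite [ltLHS]/Num.norm/= mx_normrE.
by apply/bigmax_ltP; split => // -[i j] _ /=; rewrite (ord1 i).
Qed.

Lemma norm_delta n (i : 'I_n) : `|delta_mx 0 i : 'rV[R]_n| = 1.
Proof.
apply/eqP; rewrite eq_le; apply/andP; split.
  apply: norm_row_le => // j; rewrite mxE eqxx/=.
  by case: (j == i); rewrite ?normr1 ?normr0.
by apply: le_trans (norm_entry _ i); rewrite mxE !eqxx normr1.
Qed.

Lemma normZ n (k : R) (v : 'rV[R]_n) : `|k *: v| = `|k| * `|v|.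
Proof. exact: normrZ. Qed.

Lemma norm_mulmx n m (v : 'rV[R]_n) (L : 'M[R]_(n, m)) :
  `|v *m L| <= `|v| * \sum_i `|row i L|.
Proof.
rewrite mulmx_sum_row (le_trans (ler_norm_sum _ _ _))// mulr_sumr ler_sum// => i _.
by rewrite normZ ler_wpM2r// norm_entry.
Qed.

Lemma axis_mean_value n (f : 'rV[R]_n -> R) (x : 'rV[R]_n) (i : 'I_n)
    (dl eta d : R) :
  (forall y, `|y - x| < dl -> [/\ {for y, continuous f},
     derivable f y (delta_mx 0 i) & `|'D_(delta_mx 0 i) f y - d| <= eta]) ->
  forall p t, `|p - x| < dl -> `|p + t *: delta_mx 0 i - x| < dl ->
  `|f (p + t *: delta_mx 0 i) - f p - t * d| <= eta * `|t|.
Proof.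
move=> Hf p t.
wlog t0 : p t / 0 <= t.
  move=> W px qx; have [t0|t0] := leP 0 t; first exact: W.
  have qp : p + t *: delta_mx 0 i + (- t) *: delta_mx 0 i = p.
    by rewrite -addrA -scalerDl subrr scale0r addr0.
  have := W (p + t *: delta_mx 0 i) (- t).
  rewrite oppr_ge0 (ltW t0) qp => /(_ isT qx px).
  by rewrite normrN -[in leLHS]normrN; congr (`|_| <= _); ring.
move=> px qx.
have [->|tn0] := eqVneq t 0.
  by rewrite scale0r addr0 subrr mul0r subr0 normr0 mulr0.
have tp : 0 < t by rewrite lt_neqAle eq_sym tn0.
pose e := delta_mx 0 i : 'rV[R]_n.
have seg s : 0 <= s <= t -> `|p + s *: e - x| < dl.
  move=> /andP[s0 st].
  have -> : p + s *: e - x =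
     (1 - s / t) *: (p - x) + (s / t) *: (p + t *: e - x).
    apply/rowP => j; rewrite !mxE.
    by field.
  have u0 : 0 <= s / t by rewrite divr_ge0// ltW.
  have u1 : s / t <= 1 by rewrite ler_pdivrMr// mul1r.
  rewrite (le_lt_trans (ler_normD _ _))// !normZ.
  rewrite (ger0_norm u0) ger0_norm ?subr_ge0//.
  have := px; have := qx; rewrite -/e.
  set a := `|p - x|; set b := `|_ - x|; set u := s / t in u0 u1 *.
  move=> bd ad.
  have [->|un0] := eqVneq u 0; first by rewrite subr0 mul1r mul0r addr0.
  have up : 0 < u by rewrite lt_neqAle eq_sym un0.
  have : u * b < u * dl by rewrite ltr_pM2l.
  have : (1 - u) * a <= (1 - u) * dl by rewrite ler_wpM2l ?subr_ge0// ltW.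
  lra.
pose g (s : R) := f (p + s *: e).
have gc : {within `[0, t], continuous g}.
  apply: continuous_in_subspaceT => s; rewrite inE/= in_itv/= => /seg sx.
  have [fc _ _] := Hf _ sx.
  rewrite /g; apply: (@continuous_comp _ _ _ (fun s : R => p + s *: e) f) => //.
  apply: continuousD; first exact: cst_continuous.
  exact: scalel_continuous.
have gd s : s \in `]0, t[%R -> is_derive s 1 g ('D_e f (p + s *: e)).
  rewrite in_itv/= => /andP[s0 st].
  have /seg/Hf[_ df _] : 0 <= s <= t by rewrite !ltW.
  have E : (fun h : R => h^-1 *: ((g \o shift s) (h *: 1) - g s)) =
      (fun h => h^-1 *: ((f \o shift (p + s *: e)) (h *: e) - f (p + s *: e))).
    apply/funext => h /=; rewrite /g; congr (_ *: (f _ - _)).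
    by rewrite scalerDl -[h *: 1]/(h * 1) mulr1 addrCA.
  have E1 : derivable g s 1 by rewrite /derivable E.
  by split => //; rewrite /derive E.
have [c + gE] := MVT tp gd gc.
rewrite in_itv/= => /andP[c0 ct].
have /seg/Hf[_ _ dc] : 0 <= c <= t by rewrite !ltW.
have -> : f (p + t *: delta_mx 0 i) - f p - t * d = ('D_e f (p + c *: e) - d) * t.
  move: gE; rewrite /g scale0r addr0 subr0 -/e => ->; ring.
by rewrite normrM ler_wpM2r.
Qed.

(** The coordinates of [z] are replaced by those of [y] one at a time; since
    the balls of the maximum norm are boxes, the intermediate points [h k] stay
    near [x]. *)
Lemma Ck1_strict n (U : set 'rV[R]_n) (f : 'rV[R]_n -> R) x :
  open U -> U x -> Ck 1 U f ->
  exists d : 'cV[R]_n, forall eps, 0 < eps -> exists2 dl, 0 < dl &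
    forall y z, `|y - x| < dl -> `|z - x| < dl ->
      `|f y - f z - ((y - z) *m d) 0 0| <= eps * `|y - z|.
Proof.
move=> oU Ux [fc fd].
exists (\col_i 'D_(delta_mx 0 i) f x) => eps eps0.
(* The [n] coordinate steps share the error; [n.+1] covers the case [n = 0]. *)
set et := eps / n.+1%:R.
have et0 : 0 < et by rewrite divr_gt0.
have /nbhs_ballP[dl dl0 H] : \forall y \near x, U y /\ forall i : 'I_n,
    `|'D_(delta_mx 0 i) f y - 'D_(delta_mx 0 i) f x| <= et.
  apply: (@filterI _ (nbhs x)); first exact: open_nbhs_nbhs.
  apply: (@filter_forall _ _ (fun (i : 'I_n) (y : 'rV[R]_n) =>
    `|'D_(delta_mx 0 i) f y - 'D_(delta_mx 0 i) f x| <= et) (nbhs x)).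
  move=> i; have [_ [/(_ _ Ux) dc _]] := fd i.
  move/cvgrPdist_le: dc => /(_ _ et0); apply: filterS => y.
  by rewrite distrC.
exists dl => // y z yx zx.
have xb w : `|w - x| < dl -> U w /\ forall i : 'I_n,
    `|'D_(delta_mx 0 i) f w - 'D_(delta_mx 0 i) f x| <= et.
  by move=> wx; apply: H; rewrite -ball_normE/= distrC.
pose h k : 'rV[R]_n := \row_i (if (i < k)%N then y 0 i else z 0 i).
have hx k : `|h k - x| < dl.
  apply: norm_row_lt => // i; rewrite !mxE.
  case: ifP => _.
    by apply: le_lt_trans yx; have := norm_entry (y - x) i; rewrite !mxE.
  by apply: le_lt_trans zx; have := norm_entry (z - x) i; rewrite !mxE.
have hS (i : 'I_n) : h i.+1 = h i + (y 0 i - z 0 i) *: delta_mx 0 i.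
  apply/rowP => j; rewrite !mxE eqxx/= ltnS leq_eqVlt.
  have [->|ji] := eqVneq j i; first by rewrite eqxx ltnn/=; ring.
  rewrite (_ : (val j == val i) = false) /=; last exact/negbTE.
  by rewrite mulr0 addr0.
have -> : f y - f z = \sum_(i < n) (f (h i.+1) - f (h i)).
  rewrite -(big_mkord xpredT (fun i => f (h i.+1) - f (h i))) telescope_sumr//.
  congr (f _ - f _); apply/rowP => i; rewrite !mxE ?ltn_ord//.
rewrite mxE -sumrB.
apply: (@le_trans _ _ (\sum_(i < n) et * `|y - z|)).
  apply: (le_trans (ler_norm_sum _ _ _)); apply: ler_sum => i _.
  rewrite !mxE hS.
  apply: (@le_trans _ _ (et * `|y 0 i - z 0 i|)); last first.
    rewrite ler_wpM2l ?(ltW et0)//.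
    by have := norm_entry (y - z) i; rewrite !mxE.
  apply: (@axis_mean_value _ _ x _ dl) => //; last by rewrite -hS.
  move=> w /xb[Uw dw]; split; [exact: fc| |exact: dw].
  by have [+ _] := fd i; apply.
rewrite sumr_const card_ord -mulr_natl mulrA ler_wpM2r//.
rewrite /et mulrCA ger_pMr// ler_pdivrMr// mul1r ler_nat//.
Unshelve. all: by end_near. Qed.

(** [sd A F x L]: within [A], the map [F] is strictly differentiable at [x] with
    derivative [L], acting on row vectors.  Such a derivative controls the
    differences [F y - F z] for all [y] and [z] near [x]; hence it is at the same
    time a derivative at [x], a Lipschitz bound near [x], and a statement on the
    continuity of the derivative. *)
Definition sd m n (A : set 'rV[R]_m) (F : 'rV[R]_m -> 'rV[R]_n)
    (x : 'rV[R]_m) (L : 'M[R]_(m, n)) :=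
  forall eps, 0 < eps -> exists2 dl, 0 < dl &
    forall y z, A y -> A z -> `|y - x| < dl -> `|z - x| < dl ->
      `|F y - F z - (y - z) *m L| <= eps * `|y - z|.

Lemma smooth_sd m n (A : set 'rV[R]_m) (F : 'rV[R]_m -> 'rV[R]_n) x :
  smooth_on_vec A F -> A x -> exists L, sd A F x L.
Proof.
move=> sF Ax.
have /choice[d Hd] : forall j : 'I_n, exists d : 'cV[R]_m,
    forall eps, 0 < eps -> exists2 dl, 0 < dl &
    forall y z, A y -> A z -> `|y - x| < dl -> `|z - x| < dl ->
      `|F y 0 j - F z 0 j - ((y - z) *m d) 0 0| <= eps * `|y - z|.
  move=> j; have [U [g [oU Ux /(_ 1%N) Cg gF]]] := sF j x Ax.
  have [d Hd] := Ck1_strict oU Ux Cg; exists d => eps /Hd[dl dl0 {}Hd].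
  have /nbhs_ballP[dl' dl'0 H] : nbhs x U by exact: open_nbhs_nbhs.
  exists (Num.min dl dl') => [|y z Ay Az]; first by rewrite lt_min dl0.
  rewrite !lt_min => /andP[y1 y2] /andP[z1 z2].
  rewrite !gF; first exact: Hd.
    by split => //; apply: H; rewrite -ball_normE/= distrC.
  by split => //; apply: H; rewrite -ball_normE/= distrC.
exists (\matrix_(i, j) d j i 0) => eps eps0.
have /choice[dl Hdl] : forall j : 'I_n, exists dl, 0 < dl /\
    forall y z, A y -> A z -> `|y - x| < dl -> `|z - x| < dl ->
      `|F y 0 j - F z 0 j - ((y - z) *m d j) 0 0| <= eps * `|y - z|.
  by move=> j; have [dl ? ?] := Hd j _ eps0; exists dl.
exists (\big[Num.min/1]_j dl j).
  by apply/bigmin_gtP; split => // j _; have [] := Hdl j.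
move=> y z Ay Az /bigmin_gtP[_ yx] /bigmin_gtP[_ zx].
apply: norm_row_le => [|j]; first by rewrite mulr_ge0// ltW.
have [_ /(_ y z Ay Az (yx j isT) (zx j isT))] := Hdl j.
rewrite !mxE; congr (`|_ - _| <= _).
by apply: eq_bigr => i _; rewrite !mxE.
Qed.

Lemma sd_id m (A : set 'rV[R]_m) x : sd A id x 1%:M.
Proof.
move=> eps eps0; exists 1 => // y z _ _ _ _.
by rewrite mulmx1 subrr normr0 mulr_ge0// ltW.
Qed.

Lemma sd_subset m n (A B : set 'rV[R]_m) (F : 'rV[R]_m -> 'rV[R]_n) x L :
  A `<=` B -> sd B F x L -> sd A F x L.
Proof.
by move=> AB sF eps /sF[dl dl0 h]; exists dl => // y z /AB By /AB Bz; exact: h.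
Qed.

(** Only the germs at [x] of the set and of the map matter. *)
Lemma sd_germ m n (A B : set 'rV[R]_m) (F G : 'rV[R]_m -> 'rV[R]_n) x L :
  sd A F x L -> (\forall y \near x, B y -> A y /\ F y = G y) -> sd B G x L.
Proof.
move=> sF /nbhs_ballP[d d0 Hd] eps /sF[dl dl0 H].
have nb y : `|y - x| < Num.min d dl -> B y -> A y /\ F y = G y.
  rewrite lt_min => /andP[yd _]; apply: Hd.
  by rewrite -ball_normE/= distrC.
exists (Num.min d dl) => [|y z By Bz yx zx]; first by rewrite lt_min d0.
have [Ay <-] := nb _ yx By; have [Az <-] := nb _ zx Bz.
by move: yx zx; rewrite !lt_min => /andP[_ ?] /andP[_ ?]; apply: H.
Qed.

Lemma sd_lipschitz m n (A : set 'rV[R]_m) (F : 'rV[R]_m -> 'rV[R]_n) x L :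
  sd A F x L -> exists2 C, 0 < C & exists2 dl, 0 < dl &
    forall y z, A y -> A z -> `|y - x| < dl -> `|z - x| < dl ->
      `|F y - F z| <= C * `|y - z|.
Proof.
move=> /(_ _ ltr01)[dl dl0 H].
exists (1 + \sum_i `|row i L|); first by rewrite ltr_pwDl// sumr_ge0.
exists dl => // y z Ay Az yx zx.
have := lerD (H _ _ Ay Az yx zx) (norm_mulmx (y - z) L).
rewrite [_ * \sum_i _]mulrC -mulrDl; apply: le_trans.
by apply: le_trans (ler_normD _ _); rewrite subrK.
Qed.

Lemma sd_cvg m n (A : set 'rV[R]_m) (F : 'rV[R]_m -> 'rV[R]_n) x L :
  A x -> sd A F x L ->
  forall r, 0 < r -> \forall y \near x, A y -> `|F y - F x| < r.
Proof.
move=> Ax /sd_lipschitz[C C0 [dl dl0 H]] r r0.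
apply/nbhs_ballP; exists (Num.min dl (r / C)).
  by rewrite /= lt_min dl0 divr_gt0.
move=> y; rewrite -ball_normE/= distrC lt_min => /andP[y1 y2] Ay.
apply: (le_lt_trans (H _ _ Ay Ax y1 _)); first by rewrite subrr normr0.
by rewrite mulrC -ltr_pdivlMr.
Qed.

Lemma sd_comp m n p (A : set 'rV[R]_m) (B : set 'rV[R]_n)
    (F : 'rV[R]_m -> 'rV[R]_n) (G : 'rV[R]_n -> 'rV[R]_p) x L K :
  A x -> sd A F x L -> sd B G (F x) K ->
  (\forall y \near x, A y -> B (F y)) -> sd A (G \o F) x (L *m K).
Proof.
move=> Ax sF sG AB eps eps0.
have [C C0 [d1 d10 H1]] := sd_lipschitz sF.
pose k := 1 + \sum_i `|row i K|.
have k0 : 0 < k by rewrite ltr_pwDl// sumr_ge0.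
have e10 : 0 < eps / 2 / C by rewrite !divr_gt0.
have e20 : 0 < eps / 2 / k by rewrite !divr_gt0.
have [d2 d20 H2] := sG _ e10.
have [d3 d30 H3] := sF _ e20.
have /nbhs_ballP[d d0 Hd] : \forall y \near x,
    (A y -> B (F y)) /\ (A y -> `|F y - F x| < d2).
  by apply: filterI AB (sd_cvg Ax sF d20).
exists (Num.min (Num.min d1 d3) d) => [|y z Ay Az].
  by rewrite !lt_min d10 d30.
rewrite !lt_min => /andP[/andP[y1 y3] yd] /andP[/andP[z1 z3] zd].
have [/(_ Ay) By /(_ Ay) y2] : (A y -> B (F y)) /\ (A y -> `|F y - F x| < d2).
  by apply: Hd; rewrite -ball_normE/= distrC.
have [/(_ Az) Bz /(_ Az) z2] : (A z -> B (F z)) /\ (A z -> `|F z - F x| < d2).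
  by apply: Hd; rewrite -ball_normE/= distrC.
have Q1 := H2 _ _ By Bz y2 z2.
have Q2 := H3 _ _ Ay Az y3 z3.
have Q3 := H1 _ _ Ay Az y1 z1.
have -> : (G \o F) y - (G \o F) z - (y - z) *m (L *m K) =
  (G (F y) - G (F z) - (F y - F z) *m K) + (F y - F z - (y - z) *m L) *m K.
  by rewrite /= [(_ - _ - _) *m K]mulmxBl mulmxA addrA subrK.
apply: (le_trans (ler_normD _ _)).
rewrite [eps]splitr mulrDl lerD//.
  apply: (le_trans Q1); apply: (le_trans (ler_wpM2l (ltW e10) Q3)).
  by rewrite mulrA divfK// gt_eqF.
apply: (le_trans (norm_mulmx _ _)).
apply: (@le_trans _ _ (eps / 2 / k * `|y - z| * k)).
  by rewrite ler_pM// ?sumr_ge0// /k lerDr.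
by rewrite mulrAC divfK// gt_eqF.
Qed.

Lemma sd_mulmxr m n p (A : set 'rV[R]_m) (F : 'rV[R]_m -> 'rV[R]_n) x L
    (K : 'M[R]_(n, p)) : sd A F x L -> sd A (fun y => F y *m K) x (L *m K).
Proof.
move=> sF eps eps0; pose k := 1 + \sum_i `|row i K|.
have k0 : 0 < k by rewrite ltr_pwDl// sumr_ge0.
have [|dl dl0 H] := sF (eps / k); first by rewrite divr_gt0.
exists dl => // y z Ay Az yx zx.
rewrite mulmxA -!mulmxBl (le_trans (norm_mulmx _ _))//.
apply: (@le_trans _ _ (eps / k * `|y - z| * k)).
  by rewrite ler_pM ?sumr_ge0 ?H// /k lerDr.
by rewrite mulrAC divfK// gt_eqF.
Qed.

Lemma sd_sum m n (I : finType) (A : set 'rV[R]_m)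
    (F : I -> 'rV[R]_m -> 'rV[R]_n) x (L : I -> 'M[R]_(m, n)) :
  (forall i, sd A (F i) x (L i)) -> sd A (fun y => \sum_i F i y) x (\sum_i L i).
Proof.
move=> sF eps eps0; pose k : R := #|I|.+1%:R.
have k0 : 0 < k by rewrite ltr0n.
have /choice[dl Hdl] : forall i, exists dl, 0 < dl /\
    forall y z, A y -> A z -> `|y - x| < dl -> `|z - x| < dl ->
      `|F i y - F i z - (y - z) *m L i| <= eps / k * `|y - z|.
  by move=> i; have [|dl ? ?] := sF i (eps / k); [rewrite divr_gt0|exists dl].
exists (\big[Num.min/1]_i dl i).
  by apply/bigmin_gtP; split => // i _; have [] := Hdl i.
move=> y z Ay Az /bigmin_gtP[_ yx] /bigmin_gtP[_ zx].
rewrite -sumrB mulmx_sumr -sumrB (le_trans (ler_norm_sum _ _ _))//.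
apply: (@le_trans _ _ (\sum_(i in I) eps / k * `|y - z|)).
  by apply: ler_sum => i _; have [_] := Hdl i; apply=> //; [exact: yx|exact: zx].
rewrite sumr_const -mulr_natl mulrA ler_wpM2r// mulrCA ger_pMr//.
by rewrite ler_pdivrMr// mul1r ler_nat.
Qed.

(** The coordinate directions point into a half-space, so that derivatives are
    unique there; on its boundary they are unique along the boundary. *)
Lemma sd_uniq m n (A : set 'rV[R]_m) (F : 'rV[R]_m -> 'rV[R]_n) x L K u :
  A x -> sd A F x L -> sd A F x K ->
  (\forall t \near 0^'+, A (x + t *: u)) -> u *m L = u *m K.
Proof.
move=> Ax sL sK Au; apply/eqP; rewrite -subr_eq0 -normr_le0.
apply/ler_addgt0Pr => eps eps0; rewrite add0r.
have [un0|u0] := eqVneq u 0.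
  by rewrite un0 !mul0mx subrr normr0 ltW.
have nu : 0 < `|u| by rewrite normr_gt0.
have e0 : 0 < eps / 2 / `|u| by rewrite !divr_gt0.
have [d1 d10 H1] := sL _ e0; have [d2 d20 H2] := sK _ e0.
pose d := Num.min d1 d2.
have d0 : 0 < d by rewrite lt_min d10.
have : \forall t \near 0^'+, [/\ A (x + t *: u), 0 < t & t * `|u| < d].
  near=> t; split; first by near: t.
    by near: t; exact: nbhs_right_gt.
  rewrite -ltr_pdivlMr//; near: t; apply: nbhs_right_lt.
  by rewrite divr_gt0.
move=> /filter_ex[t [At t0 td]].
have tx : `|x + t *: u - x| < d.
  by rewrite addrC addKr normZ gtr0_norm.
move: (tx); rewrite lt_min => /andP[t1 t2].
have xx r : 0 < r -> `|x - x| < r by rewrite subrr normr0.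
have := lerD (H1 _ _ At Ax t1 (xx _ d10)) (H2 _ _ At Ax t2 (xx _ d20)).
rewrite -[in leLHS]normrN => /(le_trans (ler_normD _ _)).
set a := F _ - F _; rewrite opprB [(x + t *: u) - x]addrC addKr.
have -> : t *: u *m L - a + (a - t *: u *m K) = t *: (u *m L - u *m K).
  by rewrite addrA subrK scalerBr -!scalemxAl.
rewrite !normZ (gtr0_norm t0) => Q.
rewrite -(ler_pM2l t0); apply: (le_trans Q).
rewrite le_eqVlt; apply/orP; left; apply/eqP.
by field; rewrite gt_eqF.
Unshelve. all: by end_near. Qed.

Lemma near_ray m (x u : 'rV[R]_m) (P : set 'rV[R]_m) :
  (\forall y \near x, P y) -> \forall t \near 0^'+, P (x + t *: u).
Proof.
move=> /nbhs_ballP[d d0 Hd]; near=> t; apply: Hd; rewrite -ball_normE/=.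
have t0 : 0 < t by near: t; exact: nbhs_right_gt.
rewrite opprD addrA subrr sub0r normrN normZ gtr0_norm//.
have : t < d / (1 + `|u|).
  by near: t; apply: nbhs_right_lt; rewrite divr_gt0// ltr_pwDl.
rewrite ltr_pdivlMr ?ltr_pwDl// mulrDr mulr1; lra.
Unshelve. all: by end_near. Qed.

End StrictDerivative.

(** * Curves in a half-space *)

(* This instance lets the contraction principle apply to spaces of matrices. *)
HB.instance Definition _ (R : realType) (m n : nat) :=
  Uniform_isComplete.Build 'M[R]_(m, n) cauchy_cvg.

Section HalfSpaceCurve.
Variables (R : realType) (n : nat).
Let H := @half_space R n.

Let closed_half_ball (x : 'rV[R]_n.+1) r : closed [set y | H y /\ `|y - x| <= r].
Proof.
have -> : [set y | H y /\ `|y - x| <= r] = H `&` [set y | `|y - x| <= r] by [].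
apply: closedI.
  rewrite /H /half_space.
  apply: (@closed_comp _ _ (fun v : 'rV[R]_n.+1 => v 0 ord0) [set t | 0 <= t]).
    by move=> v _; exact: coord_continuous.
  exact: closed_ge.
apply: (@closed_comp _ _ (fun v : 'rV[R]_n.+1 => `|v - x|) [set t | t <= r]).
  move=> v _; apply: continuous_comp; last exact: norm_continuous.
  by apply: continuousB; [exact: cvg_id|exact: cst_continuous].
exact: closed_le.
Qed.

(** The curve is found by the contraction principle inside the half-space: at a
    boundary point, the iteration for a time [t >= 0] stays within distance
    [2 * t * `|v|] of [x], so that the error of the linear approximation is too
    small to push a point of the half-space across the boundary. *)
Lemma half_space_curve (phi : 'rV[R]_n.+1 -> 'rV[R]_n.+1) (x v : 'rV[R]_n.+1) :
  H x -> sd H phi x 1%:M -> v != 0 -> (x 0 ord0 = 0 -> 0 < v 0 ord0) ->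
  exists r0, [/\ 0 < r0,
    forall y z, H y -> H z -> `|y - x| < r0 -> `|z - x| < r0 ->
      `|phi y - phi z - (y - z)| <= 1 / 2 * `|y - z|,
    x 0 ord0 = 0 -> forall y t, H y -> `|y - x| < r0 ->
      phi y = phi x + t *: v -> 0 <= t
  & forall r, 0 < r <= r0 -> exists2 dl, 0 < dl &
      forall t, `|t| < dl -> (x 0 ord0 = 0 -> 0 <= t) ->
      exists y, [/\ H y, `|y - x| < r & phi y = phi x + t *: v]].
Proof.
move=> Hx sphi v0 xv.
have nv : 0 < `|v| by rewrite normr_gt0.
pose eps := if x 0 ord0 == 0 then Num.min (1 / 2) (v 0 ord0 / (4 * `|v|)) else 1 / 2.
have eps0 : 0 < eps.
  rewrite /eps; case: eqP => [/xv h|_]; last by lra.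
  rewrite lt_min; apply/andP; split; first by lra.
  by rewrite divr_gt0// mulr_gt0.
have eps1 : eps <= 1 / 2 by rewrite /eps; case: eqP => // _; rewrite ge_min lexx.
have epsv : x 0 ord0 = 0 -> eps * (4 * `|v|) <= v 0 ord0.
  move=> h; rewrite /eps h eqxx -ler_pdivlMr ?mulr_gt0//.
  by rewrite ge_min lexx orbT.
have [r0 r00 Hr] := sphi _ eps0.
have {}Hr y z : H y -> H z -> `|y - x| < r0 -> `|z - x| < r0 ->
    `|phi y - phi z - (y - z)| <= eps * `|y - z|.
  by move=> Hy Hz yx zx; have := Hr _ _ Hy Hz yx zx; rewrite mulmx1.
have xx : `|x - x| < r0 by rewrite subrr normr0.
have half y z : H y -> H z -> `|y - x| < r0 -> `|z - x| < r0 ->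
    `|phi y - phi z - (y - z)| <= 1 / 2 * `|y - z|.
  move=> Hy Hz yx zx; apply: (le_trans (Hr _ _ Hy Hz yx zx)).
  by rewrite ler_wpM2r.
exists r0; split => //.
  move=> x0 y t Hy yx yt; rewrite leNgt; apply/negP => t0.
  have := Hr _ _ Hy Hx yx xx; have := half _ _ Hy Hx yx xx.
  rewrite yt [phi x + _]addrC addrK => h1 h2.
  have yv : `|y - x| <= 2 * (`|t| * `|v|).
    have := ler_normB (t *: v) (t *: v - (y - x)).
    by rewrite subKr normZ; move: h1; set a := `|y - x|; set b := `|t *: v - _|; set c := `|t| * _; lra.
  have := le_trans (norm_entry _ ord0) h2.
  rewrite !mxE x0 subr0 ler_norml => /andP[+ _].
  move: yv (epsv x0) Hy; rewrite /H /half_space/= (ltr0_norm t0) => yv ev y0 h.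
  have h3 : eps * `|y - x| <= eps * (2 * (- t * `|v|)) by rewrite ler_wpM2l// ltW.
  have h4 : - t * (eps * (4 * `|v|)) <= - t * v 0 ord0.
    by rewrite ler_wpM2l// oppr_ge0 ltW.
  have h5 : 0 < - t * v 0 ord0 by rewrite mulr_gt0 ?xv// oppr_gt0.
  have e1 : eps * (2 * (- t * `|v|)) = - t * (eps * (4 * `|v|)) / 2 by field.
  rewrite e1 in h3.
  move: h3 h4 h5 h y0; rewrite !mulNr.
  set a := t * v 0 ord0; set b := t * (eps * _); set c := eps * _; lra.
move=> r /andP[r_gt0 rr0].
pose m := if x 0 ord0 == 0 then r else Num.min r (x 0 ord0).
have mr : m <= r by rewrite /m; case: eqP => // _; rewrite ge_min lexx.
have mx : x 0 ord0 != 0 -> m <= x 0 ord0.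
  by rewrite /m; case: eqP => // _ _; rewrite ge_min lexx orbT.
have m0 : 0 < m.
  rewrite /m; case: eqVneq => // xn0; rewrite lt_min r_gt0 lt_neqAle eq_sym xn0.
  exact: Hx.
exists (m / (2 * `|v|)) => [|t tm tb]; first by rewrite divr_gt0// mulr_gt0.
pose rho := 2 * (`|t| * `|v|).
have rhom : rho < m.
  by move: tm; rewrite ltr_pdivlMr ?mulr_gt0// /rho mulrCA.
have rho0 : 0 <= rho by rewrite /rho !mulr_ge0.
pose D := [set y | H y /\ `|y - x| <= rho].
pose T y := y - phi y + (phi x + t *: v).
have Dr y : D y -> `|y - x| < r0.
  move=> [_ yr]; apply: (le_lt_trans yr); apply: (lt_le_trans rhom).
  exact: le_trans mr rr0.
have TD y : D y -> D (T y).
  move=> Dy; have yx := Dr _ Dy; have [Hy yr] := Dy.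
  have h1 := half _ _ Hy Hx yx xx; have h2 := Hr _ _ Hy Hx yx xx.
  have TE : T y - x = t *: v - (phi y - phi x - (y - x)).
    by apply/rowP => i; rewrite !mxE; ring.
  have Tx : `|T y - x| <= rho.
    rewrite TE; apply: (le_trans (ler_normB _ _)); rewrite normZ.
    move: h1 yr; rewrite /rho; set a := `|t| * _; set b := `|y - x|; set c := `|_ - _|.
    lra.
  split => //; rewrite /H /half_space/=.
  have [x0|xn0] := eqVneq (x 0 ord0) 0; last first.
    have := le_lt_trans (le_trans (norm_entry _ ord0) Tx) (lt_le_trans rhom (mx xn0)).
    by rewrite !mxE ltr_norml => /andP[+ _]; lra.
  have t0 := tb x0.
  have := le_trans (norm_entry _ ord0) h2; rewrite ler_norml => /andP[_ h3].
  have T0 : T y 0 ord0 = t * v 0 ord0 - (phi y - phi x - (y - x)) 0 ord0.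
    by move/rowP: TE => /(_ ord0); rewrite !mxE x0 subr0.
  have h4 : eps * `|y - x| <= eps * (2 * (t * `|v|)).
    by rewrite ler_wpM2l ?(ltW eps0)//; move: yr; rewrite /rho (ger0_norm t0).
  have h5 : t * (eps * (4 * `|v|)) <= t * v 0 ord0 by rewrite ler_wpM2l ?epsv.
  have h6 : 0 <= t * v 0 ord0 by rewrite mulr_ge0// ltW// xv.
  have e1 : eps * (2 * (t * `|v|)) = t * (eps * (4 * `|v|)) / 2 by field.
  rewrite T0; rewrite e1 in h4; move: h3 h4 h5 h6.
  set b := t * v _ _; set c := t * (eps * _); set d := eps * `|y - x|.
  set a := (X in X <= d -> _); move=> h3 h4 h5 h6; rewrite -/a.
  lra.
have Tc y z : D y -> D z -> `|T y - T z| <= 1 / 2 * `|y - z|.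
  move=> Dy Dz; have := half _ _ Dy.1 Dz.1 (Dr _ Dy) (Dr _ Dz).
  rewrite -[in leLHS]normrN; congr (`|_| <= _); apply/rowP => i; rewrite !mxE; ring.
have [y [Hy yr] Ty] : exists2 y, D y & y = T y.
  pose f : {fun D >-> D} := mkfun (TD : set_fun D D T).
  have hlf : 0 <= 1 / 2 :> R by lra.
  apply: (@banach_fixed_point _ _ _ f).
  - exists (NngNum hlf); split; first by rewrite /=; lra.
    by move=> [y z] [Dy Dz]; exact: Tc.
  - exact: closed_half_ball.
  - by exists x; split => //; rewrite subrr normr0.
exists y; split => //; first by apply: (le_lt_trans yr); exact: lt_le_trans rhom mr.
have : T y - y + phi y = phi x + t *: v.
  by apply/rowP => i; rewrite !mxE; ring.
by rewrite -Ty subrr add0r.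
Qed.

End HalfSpaceCurve.

(** * Jumps of subsets of the line *)

Section Line.
Variable R : realType.
Implicit Types (T : set R) (s t a b : R) (u v : bool).

Definition frontier (X : topologicalType) (A B : set X) : set X :=
  closure B `&` closure (A `\` B).

(** For a set whose germs on both sides of [t] are constant, this says that the
    two germs differ.  The value at [t] itself is ignored, and the formula does
    not depend on the parametrization of the line. *)
Definition jump T t : bool :=
  `[< limit_point T t /\ limit_point (~` T) t >].

(** The germs of [T] on the left and on the right of [t] are constant. *)
Definition sides T t u v := exists2 d, 0 < d &
  (forall s, t - d < s < t -> (T s <-> u)) /\
  (forall s, t < s < t + d -> (T s <-> v)).

Lemma frontier_lineP T t : frontier setT T t <->
  (forall d, 0 < d -> exists2 s, `|s - t| < d & T s) /\
  (forall d, 0 < d -> exists2 s, `|s - t| < d & ~ T s).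
Proof.
have cl (B : set R) : closure B t <->
    forall d, 0 < d -> exists2 s, `|s - t| < d & B s.
  split=> [cB d d0|H U /nbhs_ballP[d d0 dU]].
    have [|s [Bs]] := cB (ball t d); first exact: nbhsx_ballx.
    by rewrite -ball_normE/= distrC => ?; exists s.
  have [s st Bs] := H _ d0; exists s; split => //; apply: dU.
  by rewrite -ball_normE/= distrC.
rewrite /frontier/= setTD; split => -[/cl c1 /cl c2]; split => //.
all: by move=> d /c2[s ? ?]; exists s.
Qed.

Lemma limit_lineP T t : limit_point T t <->
  forall d, 0 < d -> exists s, [/\ s != t, `|s - t| < d & T s].
Proof.
split=> [lT d d0|H U /nbhs_ballP[d d0 dU]].
  have [|s [st Ts]] := lT (ball t d); first exact: nbhsx_ballx.
  by rewrite -ball_normE/= distrC => ?; exists s.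
have [s [st sd Ts]] := H _ d0; exists s; split => //; apply: dU.
by rewrite -ball_normE/= distrC.
Qed.

(** Connectedness of the interval. *)
Lemma no_frontier_const T a b :
  (forall t, a < t < b -> ~ frontier setT T t) ->
  exists u, forall t, a < t < b -> (T t <-> u).
Proof.
move=> H; apply: contrapT => /forallNP N.
have [t1 ab1 T1] : exists2 t, a < t < b & T t.
  apply: contrapT => /forall2NP E; apply: (N false) => t tab.
  by split => // Tt; have [] := E t.
have [t2 ab2 T2] : exists2 t, a < t < b & ~ T t.
  apply: contrapT => /forall2NP E; apply: (N true) => t tab.
  by split => // _; have [//|/contrapT] := E t.
have cI : connected [set` `]a, b[%R] by exact/connected_intervalP/interval_is_interval.
suff : [set` `]a, b[%R] `&` T = [set` `]a, b[%R].
  by move/seteqP => [_ /(_ t2)]; rewrite /= in_itv/= => /(_ ab2)[].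
apply: cI.
- by exists t1; split => //=; rewrite in_itv/=.
- exists (interior T); first exact: open_interior.
  apply/seteqP; split=> [t [/= tab Tt]|t [/= tab /interior_subset Tt]]; last by [].
  split => //; apply: contrapT => nT.
  move: (tab); rewrite in_itv/= => /H; apply; split.
    exact: subset_closure.
  rewrite setTD -[closure _]setCK; move=> cT.
  by apply: nT; rewrite /= -[T]setCK interiorC.
- exists (closure T); first exact: closed_closure.
  apply/seteqP; split=> [t [/= tab Tt]|t [/= tab cT]].
    by split => //; exact: subset_closure.
  split => //; apply: contrapT => nT.
  move: (tab); rewrite in_itv/= => /H; apply; split => //.
  by apply: subset_closure; rewrite setTD.
Qed.

Lemma finite_frontier_sides T (l : seq R) a b t : a < t < b ->
  (forall s, a < s < b -> frontier setT T s -> s \in l) ->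
  exists u v, sides T t u v.
Proof.
move=> /andP[at_ tb] Hl.
have [d [d0 dab dl]] : exists d, [/\ 0 < d, d <= Num.min (t - a) (b - t) &
    forall s, s \in l -> s != t -> d <= `|s - t|].
  elim: l {Hl} => [|x l [d [d0 dm dl]]].
    by exists (Num.min (t - a) (b - t)); rewrite lexx lt_min !subr_gt0 at_.
  have [->|xt] := eqVneq x t.
    exists d; split => // s; rewrite in_cons => /orP[/eqP->|]; last exact: dl.
    by rewrite eqxx.
  exists (Num.min d `|x - t|); split => [||s].
  - by rewrite lt_min d0 normr_gt0 subr_eq0.
  - by rewrite ge_min dm.
  - rewrite in_cons ge_min => /orP[/eqP-> _|sl /(dl _ sl)->//].
    by rewrite lexx orbT.
have nl s : s != t -> `|s - t| < d -> ~ frontier setT T s.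
  move=> st sd fs.
  have sl : s \in l.
    apply: Hl fs; move: (lt_le_trans sd dab).
    rewrite lt_min => /andP[]; rewrite !ltr_norml.
    by move=> /andP[? _] /andP[_ ?]; apply/andP; split; lra.
  by have := dl _ sl st; rewrite leNgt sd.
have [s|u Hu] := @no_frontier_const T (t - d) t.
  by move=> /andP[? ?]; apply: nl; [rewrite lt_eqF|rewrite ltr_norml; lra].
have [s|v Hv] := @no_frontier_const T t (t + d).
  by move=> /andP[? ?]; apply: nl; [rewrite gt_eqF|rewrite ltr_norml; lra].
by exists u, v, d.
Qed.

Lemma sides_limit T t u v : sides T t u v -> limit_point T t <-> u || v.
Proof.
move=> [d d0 [Hu Hv]]; split.
  move=> /limit_lineP/(_ _ d0)[s [st]]; rewrite ltr_norml => /andP[s1 s2] Ts.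
  have [lt|] := ltP s t.
    by apply/orP; left; apply/(Hu s) => //; apply/andP; split; lra.
  rewrite le_eqVlt eq_sym (negbTE st)/= => lt.
  by apply/orP; right; apply/(Hv s) => //; apply/andP; split; lra.
move=> uv; apply/limit_lineP => d' d'0.
pose m := Num.min d d' / 2.
have m0 : 0 < m by rewrite divr_gt0// lt_min d0.
have md : m < d.
  by rewrite /m ltr_pdivrMr// (le_lt_trans (y := d)) ?ge_min ?lexx//; lra.
have md' : m < d'.
  by rewrite /m ltr_pdivrMr// (le_lt_trans (y := d')) ?ge_min ?lexx ?orbT//; lra.
case/orP: uv => [u1|v1].
  exists (t - m); split; [by rewrite lt_eqF//; lra| |].
    by rewrite ltr_norml; apply/andP; split; lra.
  by apply/Hu => //; apply/andP; split; lra.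
exists (t + m); split; [by rewrite gt_eqF//; lra| |].
  by rewrite ltr_norml; apply/andP; split; lra.
by apply/Hv => //; apply/andP; split; lra.
Qed.

Lemma sidesC T t u v : sides T t u v -> sides (~` T) t (~~ u) (~~ v).
Proof.
move=> [d d0 [Hu Hv]]; exists d => //; split=> s.
  by move=> /Hu E; rewrite /setC/=; split=> [/E/negP|/negP nu /E].
by move=> /Hv E; rewrite /setC/=; split=> [/E/negP|/negP nu /E].
Qed.

Lemma sides_jump T t u v : sides T t u v -> jump T t = u (+) v.
Proof.
move=> H; have L := sides_limit H; have LC := sides_limit (sidesC H).
apply/asboolP/idP => [[/L + /LC]|]; first by case: u v {H L LC} => -[].
by move=> uv; split; [apply/L|apply/LC]; case: u v uv {H L LC} => -[].
Qed.

Lemma jumpU T T' t u v u' v' : T `&` T' = set0 ->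
  sides T t u v -> sides T' t u' v' -> jump (T `|` T') t = jump T t (+) jump T' t.
Proof.
move=> TT' H H'; rewrite (sides_jump H) (sides_jump H').
have dis s : T s -> T' s -> False.
  by move=> Ts T's; have : (T `&` T') s by []; rewrite TT'.
move: H H' => [d d0 [Hu Hv]] [d' d'0 [Hu' Hv']].
pose m := Num.min d d'.
have m0 : 0 < m by rewrite lt_min d0.
have md : m <= d by rewrite ge_min lexx.
have md' : m <= d' by rewrite ge_min lexx orbT.
have S : sides (T `|` T') t (u || u') (v || v').
  exists m => //; split=> s /andP[s1 s2].
    have h : T s <-> u by apply: Hu; apply/andP; split; lra.
    have h' : T' s <-> u' by apply: Hu'; apply/andP; split; lra.
    split=> [[/h ->//|/h' ->]|/orP[/h|/h']]; [by rewrite orbT|by left|by right].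
  have h : T s <-> v by apply: Hv; apply/andP; split; lra.
  have h' : T' s <-> v' by apply: Hv'; apply/andP; split; lra.
  split=> [[/h ->//|/h' ->]|/orP[/h|/h']]; [by rewrite orbT|by left|by right].
rewrite (sides_jump S).
have nu : ~~ (u && u').
  apply/negP => /andP[u1 u1']; apply: (dis (t - m / 2)).
    by apply/Hu => //; apply/andP; split; lra.
  by apply/Hu' => //; apply/andP; split; lra.
have nv : ~~ (v && v').
  apply/negP => /andP[u1 u1']; apply: (dis (t + m / 2)).
    by apply/Hv => //; apply/andP; split; lra.
  by apply/Hv' => //; apply/andP; split; lra.
by move: u v u' v' nu nv {Hu Hv Hu' Hv' S} => [] [] [] [].
Qed.

(** Telescoping: on the right of [a], the set [T] changes at the points of [l]
    only, and finally it is left for good. *)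
Lemma sum_jump_right T (l : seq R) a v d : (forall t, T t -> t <= 1 / 2) ->
  a < 1 -> 0 < d -> (forall s, a < s < a + d -> (T s <-> v)) ->
  path <%R a l -> (forall t, t \in l -> t < 1) ->
  (forall t, a < t < 1 -> frontier setT T t -> t \in l) ->
  \big[addb/false]_(t <- l) jump T t = v.
Proof.
move=> Tle; elim: l a v d => [|x l IH] a v d a1 d0 Hv /=.
  move=> _ _ nf; rewrite big_nil.
  have [|u Hu] := @no_frontier_const T a 1; first by move=> t /nf h /h.
  pose m := Num.min 1 (a + d).
  have am : a < m by rewrite lt_min a1/= ltrDl.
  have m1 : m <= 1 by rewrite ge_min lexx.
  have md : m <= a + d by rewrite ge_min lexx orbT.
  have uE : T ((a + m) / 2) <-> u by apply: Hu; apply/andP; split; lra.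
  have vE : T ((a + m) / 2) <-> v by apply: Hv; apply/andP; split; lra.
  suff u0 : u = false.
    by apply/esym/negbTE/negP => /vE/uE; rewrite u0.
  (* [z] lies in the interval and beyond [1 / 2], hence outside [T] *)
  pose z := Num.max (a + 1) (7 / 4) / 2.
  have z1 : a + 1 <= z * 2 by rewrite /z divfK// le_max lexx.
  have z2 : 7 / 4 <= z * 2 by rewrite /z divfK// le_max lexx orbT.
  have z3 : z * 2 < 2 by rewrite /z divfK// gt_max; apply/andP; split; lra.
  apply/negbTE/negP => /(Hu z) Tz.
  have /Tz/Tle : a < z < 1 by apply/andP; split; lra.
  lra.
move=> /andP[ax xl] l1 nf; rewrite big_cons.
have x1 : x < 1 by apply: l1; rewrite mem_head.
have nf' t : x < t < 1 -> frontier setT T t -> t \in l.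
  move=> /andP[xt t1] /nf; rewrite in_cons (gt_eqF xt)/=; apply.
  by rewrite (lt_trans ax).
have [u [u' S]] : exists u v, sides T x u v.
  by apply: (@finite_frontier_sides T (x :: l) a 1) => //; rewrite ax.
rewrite (sides_jump S); case: S => d' d'0 [Hu Hu'].
rewrite (IH x u' d') //; last by move=> t tl; apply: l1; rewrite in_cons tl orbT.
rewrite -addbA addbb addbF.
have [|w Hw] := @no_frontier_const T a x.
  move=> t /andP[at_ tx] /nf.
  rewrite at_ (lt_trans tx)// => /(_ isT).
  rewrite in_cons (lt_eqF tx)/= => tl.
  by have := order_path_min lt_trans xl => /allP/(_ _ tl); rewrite ltNge (ltW tx).
suff [-> ->] : u = w /\ v = w by [].
split.
  pose z := Num.max a (x - d').
  have z1 : a <= z by rewrite le_max lexx.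
  have z2 : x - d' <= z by rewrite le_max lexx orbT.
  have z3 : z < x by rewrite gt_max ax/=; lra.
  have h1 : T ((z + x) / 2) <-> u by apply: Hu; apply/andP; split; lra.
  have h2 : T ((z + x) / 2) <-> w by apply: Hw; apply/andP; split; lra.
  by apply/idP/idP => [/h1/h2|/h2/h1].
pose z := Num.min x (a + d).
have z1 : z <= x by rewrite ge_min lexx.
have z2 : z <= a + d by rewrite ge_min lexx orbT.
have z3 : a < z by rewrite lt_min ax/=; lra.
have h1 : T ((z + a) / 2) <-> v by apply: Hv; apply/andP; split; lra.
have h2 : T ((z + a) / 2) <-> w by apply: Hw; apply/andP; split; lra.
by apply/idP/idP => [/h1/h2|/h2/h1].
Qed.

Lemma sum_jump T (l : seq R) : (forall t, T t -> `|t| <= 1 / 2) ->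
  uniq l -> (forall t, t \in l -> -1 < t < 1) ->
  (forall t, -1 < t < 1 -> frontier setT T t -> t \in l) ->
  \big[addb/false]_(t <- l) jump T t = false.
Proof.
move=> T2 ul l1 fl.
have sl : perm_eq l (sort <=%R l) by rewrite perm_sym perm_sort.
rewrite (perm_big _ sl)/=.
apply: (@sum_jump_right T _ (-1) false (1 / 2)).
- by move=> t /T2; rewrite ler_norml => /andP[].
- lra.
- lra.
- move=> s /andP[s1 s2]; split => // /T2; rewrite ler_norml => /andP[? _].
  by suff : false by []; move: s1 s2; lra.
- rewrite (path_sortedE lt_trans); apply/andP; split.
    by apply/allP => t; rewrite mem_sort => /l1/andP[].
  by rewrite sort_lt_sorted.
- by move=> t; rewrite mem_sort => /l1/andP[].
- by move=> t /fl; rewrite mem_sort.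
Qed.

End Line.

(** * Compact curves have an even number of boundary points *)

Section OneManifold.
Variables (R : realType) (W : topologicalType).

Definition arc_domain (b : bool) : set R :=
  [set t | -1 < t < 1 /\ (b -> 0 <= t)].

(** A parametrization of a neighbourhood of [x] in [A] by an open interval, or by
    a half-open one if [b] holds.  The last condition says that [e] is an open
    map to [A]; it stands for the continuity of the inverse. *)
Record arc_chart (A : set W) (b : bool) (x : W) (e : R -> W) : Prop := ArcChart {
  arc0 : e 0 = x;
  arc_in : forall t, arc_domain b t -> A (e t);
  arc_inj : forall s t, arc_domain b s -> arc_domain b t -> e s = e t -> s = t;
  arc_cts : forall t, arc_domain b t -> forall V, nbhs (e t) V ->
    exists2 d, 0 < d & forall s, arc_domain b s -> `|s - t| < d -> V (e s);
  arc_opn : forall t d, arc_domain b t -> 0 < d ->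
    \forall y \near e t, A y ->
      exists s, [/\ arc_domain b s, `|s - t| < d & y = e s] }.

Variables (A : set W) (bd : W -> bool) (e : W -> R -> W).
Hypothesis WH : hausdorff_space W.
Hypothesis cA : compact A.
Hypothesis eP : forall x, A x -> arc_chart A (bd x) x (e x).

Let I x := arc_domain (bd x).
Let pull x (B : set W) : set R := [set t | I x t /\ B (e x t)].
(** At a boundary point, the time domain of the chart has only one side, and the
    jump is the value of the germ of [B] on this side. *)
Let jmp B y := jump (pull y B) 0.

Let finite_frontier (B : set W) :=
  exists l : seq W, forall y, frontier A B y -> y \in l.

Let I0 x : I x 0. Proof. by split=> //; apply/andP; split; lra. Qed.

Let interior_time x t : I x t -> ~~ bd x \/ t != 0 ->
  exists2 d, 0 < d & forall s, `|s - t| < d -> I x s.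
Proof.
move=> [/andP[t1 t2] bt] nb.
have [b0|b1] := boolP (bd x).
  have t0 : 0 < t.
    by rewrite lt_neqAle eq_sym bt// andbT; case: nb; rewrite ?b0.
  exists (Num.min t (1 - t)) => [|s]; first by rewrite lt_min t0 subr_gt0.
  rewrite lt_min !ltr_norml => /andP[/andP[? ?] /andP[? ?]].
  by split=> [|_]; [apply/andP; split; lra|lra].
exists (Num.min (1 + t) (1 - t)) => [|s].
  by rewrite lt_min subr_gt0 t2 andbT; lra.
rewrite lt_min !ltr_norml => /andP[/andP[? ?] /andP[? ?]].
by split=> [|bx]; [apply/andP; split; lra|rewrite bx in b1].
Qed.

Let limit_pull x t B : A x -> I x t -> B `<=` A ->
  limit_point B (e x t) <-> limit_point (pull x B) t.
Proof.
move=> /eP ex It BA; split.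
  move=> lB; apply/limit_lineP => d d0.
  have [y [yx By]] := lB _ (arc_opn ex It d0).
  move=> /(_ (BA _ By))[s [Is sd ys]]; exists s; split => //.
    by apply: contra_neq yx => <-.
  by split => //; rewrite -ys.
move=> /limit_lineP lT V /(arc_cts ex It)[d d0 Hd].
have [s [st sd [Is Bs]]] := lT _ d0.
exists (e x s); split => //; last exact: Hd.
by apply: contra_neq st => /(arc_inj ex); apply.
Qed.

Let limit_pullC x t B : A x -> I x t -> ~~ bd x \/ t != 0 ->
  limit_point (pull x (A `\` B)) t <-> limit_point (~` pull x B) t.
Proof.
move=> /eP ex It /(interior_time It)[d0 d00 Id].
split=> /limit_lineP H; apply/limit_lineP => d d_gt0.
  have [s [st sd [Is [As nBs]]]] := H _ d_gt0.
  by exists s; split => // -[].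
have [|s [st]] := H (Num.min d d0); first by rewrite lt_min d_gt0.
rewrite lt_min => /andP[sd /Id Is] nT; exists s; split => //; split => //.
by split; [exact: (arc_in ex)|move=> Bs; apply: nT].
Qed.

(** The frontier points of a set are seen in every chart. *)
Let pull_frontier x B : A x -> B `<=` A -> finite_frontier B ->
  exists l : seq R, forall t, -1 < t < 1 -> frontier setT (pull x B) t -> t \in l.
Proof.
move=> Ax BA [l Hl]; have ex := eP Ax.
pose psi y := xget 0 [set t | I x t /\ e x t = y].
exists (0 :: map psi l) => t t1 /frontier_lineP[f1 f2].
have [->|t0] := eqVneq t 0; first by rewrite mem_head.
have It : I x t.
  split => // bx; rewrite leNgt; apply/negP => tn.
  have [|s st [[_ /(_ bx) s0] _]] := f1 (- t); first by rewrite oppr_gt0.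
  by move: st; rewrite ltr_norml; lra.
rewrite in_cons (negbTE t0)/=; apply/mapP; exists (e x t).
  apply: Hl; split=> V /(arc_cts ex It)[d d0 Hd].
    have [s sd [Is Bs]] := f1 _ d0.
    by exists (e x s); split => //; exact: Hd.
  have [d' d'0 Id] := interior_time It (or_intror t0).
  have [|s] := f2 (Num.min d d'); first by rewrite lt_min d0.
  rewrite lt_min => /andP[sd /Id Is] nT; exists (e x s); split; last exact: Hd.
  by split; [exact: (arc_in ex)|move=> Bs; apply: nT].
rewrite /psi; case: xgetP => [s -> [Is]|/(_ t)[]//].
by move=> /(arc_inj ex Is It).
Qed.

Let pull_sides x B t : A x -> B `<=` A -> finite_frontier B -> -1 < t < 1 ->
  exists u v, sides (pull x B) t u v.
Proof.
move=> Ax BA /(pull_frontier Ax BA)[l Hl] t1.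
exact: (finite_frontier_sides t1 Hl).
Qed.

Let arc x a b := [set y | exists t, [/\ I x t, a < t < b & y = e x t]].

Let arc_closure x a b : A x -> -1 < a -> b < 1 ->
  forall y, closure (arc x a b) y -> exists t, [/\ I x t, a <= t <= b & y = e x t].
Proof.
move=> Ax a1 b1; have ex := eP Ax.
pose K := [set t | I x t /\ a <= t <= b].
have cK : compact K.
  apply: (@subclosed_compact _ _ [set` `[a, b]%R]).
  - have -> : K = [set` `[a, b]%R] `&` [set t | bd x -> 0 <= t].
      apply/seteqP; split=> t [] /=; first by move=> [_ bt] ?; rewrite in_itv.
      rewrite in_itv/= => /andP[? ?] bt; split; last by apply/andP.
      by split => //; apply/andP; split; lra.
    apply: closedI; first exact: interval_closed.
    case: (bd x).
      rewrite (_ : [set t | _] = [set t | 0 <= t]); first exact: closed_ge.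
      by apply/seteqP; split=> t /=; [apply|].
    rewrite (_ : [set t | _] = setT); first exact: closedT.
    by apply/seteqP; split.
  - exact: segment_compact.
  - by move=> t [_] /=; rewrite in_itv.
have cC : {within K, continuous (e x)}.
  apply/subspace_continuousP => t [It _] V /(arc_cts ex It)[d d0 Hd].
  apply/nbhs_ballP; exists d => // s; rewrite -ball_normE/= distrC => sd [Is _].
  exact: Hd.
have cE : closed (e x @` K) := compact_closed WH (continuous_compact cC cK).
have sub : arc x a b `<=` e x @` K.
  move=> _ [t [It /andP[? ?] ->]]; exists t => //; split => //.
  by apply/andP; split; apply: ltW.
move=> y /(closure_subset sub); rewrite -(closure_id _).1//.
by move=> [t [It tab] <-]; exists t.
Qed.

Let arc_sub x a b : A x -> arc x a b `<=` A.
Proof. by move=> /eP ex _ [t [It _ ->]]; exact: (arc_in ex). Qed.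

Let arc_finite_frontier x a b : A x -> -1 < a -> b < 1 ->
  finite_frontier (arc x a b).
Proof.
move=> Ax a1 b1; have ex := eP Ax; exists [:: e x a; e x b] => y [].
move=> /(arc_closure Ax a1 b1)[t [It /andP[ta tb] ->]] cC; rewrite !inE.
have [->|nta] := eqVneq t a; first by rewrite eqxx.
have [->|ntb] := eqVneq t b; first by rewrite eqxx orbT.
exfalso.
have d0 : 0 < Num.min (t - a) (b - t).
  by rewrite lt_min !subr_gt0 !lt_neqAle eq_sym nta ntb ta.
have [y' [[Ay' nay'] /(_ Ay')[s [Is sd ys]]]] := cC _ (arc_opn ex It d0).
apply: nay'; exists s; split => //; move: sd.
by rewrite lt_min !ltr_norml => /andP[/andP[? ?] /andP[? ?]]; apply/andP; split; lra.
Qed.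

(** Otherwise the two halves of an arc through a boundary point would both be
    nonempty germs on its only side. *)
Let bd_interior x t : A x -> I x t -> t != 0 -> ~~ bd (e x t).
Proof.
move=> Ax It t0; apply/negP => bt; have ex := eP Ax.
have Ay := arc_in ex It; have ey := eP Ay.
have [d d0 Id] := interior_time It (or_intror t0).
pose a := t - d / 2; pose b := t + d / 2.
have Iab s : a <= s <= b -> I x s.
  by rewrite /a /b => /andP[? ?]; apply: Id; rewrite ltr_norml; apply/andP; split; lra.
have [/andP[a1 _] _] : I x a by apply: Iab; rewrite /a /b; apply/andP; split; lra.
have [/andP[_ b1] _] : I x b by apply: Iab; rewrite /a /b; apply/andP; split; lra.
have [/andP[t1 t2] _] := It.
have half a' b' : -1 < a' -> b' < 1 -> limit_point (pull x (arc x a' b')) t ->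
    exists2 d, 0 < d & forall s, 0 < s < 0 + d -> arc x a' b' (e (e x t) s).
  move=> a'1 b'1 lT.
  have sA := arc_sub (a := a') (b := b') Ax.
  have [u [v S]] := pull_sides (t := 0) Ay sA (arc_finite_frontier Ax a'1 b'1) (I0 (e x t)).1.
  have : limit_point (pull (e x t) (arc x a' b')) 0.
    apply/(limit_pull Ay (I0 _) sA); rewrite (arc0 ey).
    exact/(limit_pull Ax It sA).
  move=> /(sides_limit S) uv.
  have u0 : u = false.
    case: S => m m0 [Hu _]; pose s := - Num.min (m / 2) (1 / 2).
    have s1 : Num.min (m / 2) (1 / 2) <= m / 2 by rewrite ge_min lexx.
    have s3 : 0 < Num.min (m / 2) (1 / 2) by rewrite lt_min; apply/andP; split; lra.
    apply/negbTE/negP => /(Hu s) []; first by rewrite /s; apply/andP; split; lra.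
    by move=> [_ /(_ bt)]; rewrite /s oppr_ge0 leNgt s3.
  rewrite u0/= in uv; case: S => m m0 [_ Hv]; exists m => // s sm.
  by have [] := (Hv s sm).2 uv.
have [d1 d10 H1] : exists2 d, 0 < d & forall s, 0 < s < 0 + d ->
    arc x a t (e (e x t) s).
  apply: half => //; apply/limit_lineP => m m0.
  pose s := t - Num.min (m / 2) (d / 4).
  have s1 : Num.min (m / 2) (d / 4) <= m / 2 by rewrite ge_min lexx.
  have s2 : Num.min (m / 2) (d / 4) <= d / 4 by rewrite ge_min lexx orbT.
  have s3 : 0 < Num.min (m / 2) (d / 4) by rewrite lt_min; apply/andP; split; lra.
  have Is : I x s by apply: Iab; rewrite /s /a /b; apply/andP; split; lra.
  exists s; split; [by rewrite lt_eqF// /s; lra|by rewrite ltr_norml /s; lra|].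
  split => //; exists s; split => //.
  by rewrite /a /s; apply/andP; split; lra.
have [d2 d20 H2] : exists2 d, 0 < d & forall s, 0 < s < 0 + d ->
    arc x t b (e (e x t) s).
  apply: half => //; apply/limit_lineP => m m0.
  pose s := t + Num.min (m / 2) (d / 4).
  have s1 : Num.min (m / 2) (d / 4) <= m / 2 by rewrite ge_min lexx.
  have s2 : Num.min (m / 2) (d / 4) <= d / 4 by rewrite ge_min lexx orbT.
  have s3 : 0 < Num.min (m / 2) (d / 4) by rewrite lt_min; apply/andP; split; lra.
  have Is : I x s by apply: Iab; rewrite /s /a /b; apply/andP; split; lra.
  exists s; split; [by rewrite gt_eqF// /s; lra|by rewrite ltr_norml /s; lra|].
  split => //; exists s; split => //.
  by rewrite /b /s; apply/andP; split; lra.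
pose s := Num.min d1 d2 / 2.
have s1 : Num.min d1 d2 <= d1 by rewrite ge_min lexx.
have s2 : Num.min d1 d2 <= d2 by rewrite ge_min lexx orbT.
have s3 : 0 < Num.min d1 d2 by rewrite lt_min d10.
have [r1 [Ir1 /andP[_ r1t] E1]] : arc x a t (e (e x t) s).
  by apply: H1; rewrite /s; apply/andP; split; lra.
have [r2 [Ir2 /andP[tr2 _] E2]] : arc x t b (e (e x t) s).
  by apply: H2; rewrite /s; apply/andP; split; lra.
have r12 : r1 = r2 by apply: (arc_inj ex) => //; rewrite -E1.
by move: r1t; rewrite r12 ltNge (ltW tr2).
Qed.

(** The jump of a set at a point can be computed in every chart. *)
Let jmp_chart x t B : A x -> I x t -> B `<=` A ->
  jmp B (e x t) = jump (pull x B) t.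
Proof.
move=> Ax It BA; have ex := eP Ax.
have [->|t0] := eqVneq t 0; first by rewrite (arc0 ex).
have nb := bd_interior Ax It t0.
have Ay := arc_in ex It; have ey := eP Ay.
have AB : A `\` B `<=` A by move=> ? [].
have L1 := limit_pull Ay (I0 _) BA; have L2 := limit_pull Ax It BA.
have C1 := limit_pull Ay (I0 _) AB; have C2 := limit_pull Ax It AB.
rewrite !(arc0 ey) in L1 C1.
have D1 := limit_pullC B Ay (I0 _) (or_introl nb).
have D2 := limit_pullC B Ax It (or_intror t0).
apply/asboolP/asboolP => -[H1 H2].
  by split; [apply/L2/L1|apply/D2/C2/C1/D1].
by split; [apply/L1/L2|apply/D1/C1/C2/D2].
Qed.

Let finite_frontierU B B' : finite_frontier B -> finite_frontier B' ->
  finite_frontier (B `|` B').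
Proof.
move=> [l Hl] [l' Hl']; exists (l ++ l') => y [+ cC]; rewrite closureU mem_cat.
have sub D : D `<=` B `|` B' -> closure (A `\` D) y.
  by move=> DB; apply: closure_subset cC => z [Az nz]; split => // /DB.
move=> [cB|cB']; apply/orP; [left; apply: Hl|right; apply: Hl']; split => //.
  by apply: sub => z; left.
by apply: sub => z; right.
Qed.

Let finite_frontierD B B' : B' `<=` A -> finite_frontier B ->
  finite_frontier B' -> finite_frontier (B' `\` B).
Proof.
move=> BA [l Hl] [l' Hl']; exists (l ++ l') => y [cD cC]; rewrite mem_cat.
have : closure ((A `\` B') `|` B) y.
  apply: closure_subset cC => z [Az nz].
  have [Bz|nB] := pselect (B z); [by right|left; split => // B'z].
  by apply: nz.
rewrite closureU => -[cA'|cB]; apply/orP; [right; apply: Hl'|left; apply: Hl].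
  by split => //; apply: closure_subset cD => z [].
by split => //; apply: closure_subset cD => z [/BA].
Qed.

(** The number of jumps of [B] is even.  The sum is taken over all large enough
    finite sets of points, since the jumps vanish outside a finite set. *)
Let balanced (B : set W) := exists2 l0 : seq W, (forall y, y \in l0 -> A y) &
  forall l, uniq l -> {subset l0 <= l} -> (forall y, y \in l -> A y) ->
    \big[addb/false]_(y <- l) jmp B y = false.

(** Modulo 2, the jumps of disjoint sets add up. *)
Let balancedU B B' : B `<=` A -> B' `<=` A -> B `&` B' = set0 ->
  finite_frontier B -> finite_frontier B' -> balanced B -> balanced B' ->
  balanced (B `|` B').
Proof.
move=> BA BA' BB' fB fB' [l0 lA H] [l0' lA' H']; exists (l0 ++ l0') => [y|l ul sl Al].
  by rewrite mem_cat => /orP[/lA|/lA'].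
rewrite (eq_big_seq (fun y => jmp B y (+) jmp B' y)) => [|y yl].
  rewrite big_split/= H ?H'// => y yl; apply: sl.
    by rewrite mem_cat yl orbT.
  by rewrite mem_cat yl.
have Ay := Al _ yl.
have [u [v S]] := pull_sides Ay BA fB (I0 y).1.
have [u' [v' S']] := pull_sides Ay BA' fB' (I0 y).1.
rewrite /jmp -(jumpU _ S S'); last first.
  apply/seteqP; split => // t [[_ h] [_ h']].
  by have : (B `&` B') (e y t) by []; rewrite BB'.
congr (jump _ 0); apply/seteqP; split => t /=.
  by move=> [It [h|h]]; [left|right].
by move=> [[It h]|[It h]]; split => //; [left|right].
Qed.

(** A set that is contained in one arc is seen entirely in one chart, where it
    is a bounded subset of the line. *)
Let balanced_arc x B : A x -> B `<=` arc x (- (1 / 2)) (1 / 2) ->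
  finite_frontier B -> balanced B.
Proof.
move=> Ax Bx fB; have ex := eP Ax.
have h1 : -1 < - (1 / 2) :> R by lra.
have h2 : 1 / 2 < 1 :> R by lra.
have BA : B `<=` A by apply: subset_trans Bx _; exact: arc_sub.
have [l Hl] := pull_frontier Ax BA fB.
pose P y := `[< exists2 t, I x t & y = e x t >].
pose psi y := xget 0 [set t | I x t /\ y = e x t].
have psiP y : P y -> I x (psi y) /\ y = e x (psi y).
  by move/asboolP => [t It yt]; rewrite /psi; case: xgetP => [s _ //|/(_ t)[]].
exists (x :: [seq e x t | t <- l & `[< I x t >]]) => [y|m um sm Am].
  rewrite in_cons => /orP[/eqP->//|/mapP[t + ->]].
  by rewrite mem_filter => /andP[/asboolP It _]; exact: (arc_in ex).
rewrite (bigID P)/= [X in _ (+) X]big_seq_cond [X in _ (+) X]big1 ?addbF.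
  rewrite -big_filter (eq_big_seq (fun y => jump (pull x B) (psi y))) => [|y].
    rewrite -(big_map psi xpredT (jump (pull x B))).
    apply: sum_jump.
    - move=> t [It /Bx[s [Is /andP[? ?] ts]]].
      by rewrite (arc_inj ex It Is ts) ler_norml; apply/andP; split; apply: ltW.
    - rewrite map_inj_in_uniq ?filter_uniq// => y z.
      rewrite !mem_filter => /andP[/psiP[_ Ey] _] /andP[/psiP[_ Ez] _] yz.
      by rewrite Ey yz -Ez.
    - move=> t /mapP[y]; rewrite mem_filter => /andP[/psiP[[? _] _] _] ->//.
    - move=> t t1 ft; have tl := Hl t t1 ft.
      have It : I x t.
        split => // bx; rewrite leNgt; apply/negP => tn.
        have [f1 _] := (frontier_lineP _ _).1 ft.
        have [|s st [[_ /(_ bx) s0] _]] := f1 (- t); first by rewrite oppr_gt0.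
        by move: st; rewrite ltr_norml; lra.
      have Pt : P (e x t) by apply/asboolP; exists t.
      apply/mapP; exists (e x t).
        rewrite mem_filter Pt/=; apply: sm; rewrite in_cons; apply/orP; right.
        by apply/mapP; exists t => //; rewrite mem_filter tl andbT; apply/asboolP.
      have [Ip] := psiP _ Pt.
      exact: (arc_inj ex).
  by rewrite mem_filter => /andP[/psiP[Ip yp] _]; rewrite -(jmp_chart Ax Ip BA) -yp.
move=> y /andP[ym nPy]; have Ay := Am _ ym.
apply/negbTE/negP => /asboolP[/(limit_pull Ay (I0 _) BA)].
rewrite (arc0 (eP Ay)) => lB _; move/negP: nPy; apply; apply/asboolP.
have cB : closure (arc x (- (1 / 2)) (1 / 2)) y.
  by move=> V /lB[z [_ /Bx Bz Vz]]; exists z.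
by have [t [It _ yt]] := arc_closure Ax h1 h2 cB; exists t.
Qed.

Let arcs (xs : seq W) := [set y | exists2 x, x \in xs & arc x (- (1 / 2)) (1 / 2) y].

(** A union of arcs is cut into disjoint pieces, each of which lies in a single
    arc. *)
Let balanced_arcs xs : (forall x, x \in xs -> A x) ->
  finite_frontier (arcs xs) /\ balanced (arcs xs).
Proof.
have h1 : -1 < - (1 / 2) :> R by lra.
have h2 : 1 / 2 < 1 :> R by lra.
elim: xs => [_|x xs IH Axs].
  have -> : arcs [::] = set0 by apply/seteqP; split=> // y [].
  split; first by exists [::] => y []; rewrite closure0.
  exists [::] => // l _ _ lA; rewrite big_seq big1// => y /lA Ay.
  apply/negbTE/negP => /asboolP[/limit_lineP/(_ _ ltr01)[s [_ _]]].
  by move=> [].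
have [|f1 b1] := IH; first by move=> z zx; apply: Axs; rewrite in_cons zx orbT.
have Ax : A x by apply: Axs; rewrite mem_head.
have As : arcs xs `<=` A.
  by move=> y [z zx]; apply: arc_sub; apply: Axs; rewrite in_cons zx orbT.
have xA : arc x (- (1 / 2)) (1 / 2) `<=` A by exact: arc_sub.
have fx := arc_finite_frontier Ax h1 h2.
have fD := finite_frontierD xA f1 fx.
have -> : arcs (x :: xs) = arcs xs `|` (arc x (- (1 / 2)) (1 / 2) `\` arcs xs).
  apply/seteqP; split=> y.
    move=> [z]; rewrite in_cons => /orP[/eqP->|zx] yz; last by left; exists z.
    by have [|] := pselect (arcs xs y); [left|right].
  move=> [[z zx yz]|[yx _]]; first by exists z; rewrite // in_cons zx orbT.
  by exists x; rewrite // mem_head.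
split; first exact: finite_frontierU.
apply: balancedU => //; first by move=> y [/xA].
  by rewrite setDE setICA setICr setI0.
by apply: balanced_arc Ax _ fD => y [].
Qed.

Let jmp_all y : A y -> jmp A y = bd y.
Proof.
move=> Ay; have ey := eP Ay.
have L : limit_point (pull y A) 0.
  apply/limit_lineP => d d0.
  have m0 : 0 < Num.min (d / 2) (1 / 2) by rewrite lt_min; apply/andP; split; lra.
  have m1 : Num.min (d / 2) (1 / 2) <= d / 2 by rewrite ge_min lexx.
  have m2 : Num.min (d / 2) (1 / 2) <= 1 / 2 by rewrite ge_min lexx orbT.
  have Is : I y (Num.min (d / 2) (1 / 2)).
    by split; [apply/andP; split; lra|rewrite ltW].
  exists (Num.min (d / 2) (1 / 2)); split; [by rewrite gt_eqF| |].
    by rewrite subr0 gtr0_norm//; lra.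
  by split => //; exact: (arc_in ey).
have [by_|nby] := boolP (bd y); last first.
  have [d d0 Id] := interior_time (I0 y) (or_introl nby).
  apply/negbTE/negP => /asboolP[_ /limit_lineP/(_ _ d0)[s [_ /Id Is]]]; apply.
  by split => //; exact: (arc_in ey).
apply/asboolP; split => //; apply/limit_lineP => d d0.
exists (- (d / 2)); split; [by rewrite lt_eqF//; lra| |].
  by rewrite subr0 normrN gtr0_norm; lra.
by move=> [[_ /(_ by_) +] _]; lra.
Qed.

(** Stokes' theorem modulo 2 for the constant function 1: on the one hand, the
    number of jumps of the whole manifold is even, because the manifold is a
    finite disjoint union of pieces of arcs; on the other hand, the whole
    manifold jumps exactly at the boundary points. *)
Theorem even_boundary (l : seq W) : uniq l ->
  (forall y, y \in l <-> A y /\ bd y) -> ~~ odd (size l).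
Proof.
move=> ul lP.
have [xs Axs Acov] : exists2 xs : seq W, (forall x, x \in xs -> A x) &
    A `<=` arcs xs.
  apply: contrapT => N.
  (* Compactness, applied to the complements of the finite unions of arcs. *)
  pose F := filter_from [set xs : seq W | forall x, x \in xs -> A x]
    (fun xs => A `\` arcs xs).
  have FF : ProperFilter F.
    apply: filter_from_proper; first apply: filter_from_filter.
    - by exists [::].
    - move=> xs ys xA yA; exists (xs ++ ys) => [x|y [Ay ny]].
        by rewrite mem_cat => /orP[/xA|/yA].
      by split; split => // -[z zs yz]; apply: ny; exists z;
        rewrite // mem_cat zs ?orbT.
    - move=> xs xA; apply: contrapT => E; apply: N; exists xs => // y Ay.
      by apply: contrapT => ny; apply: E; exists y.
  have [|p [Ap cp]] := cA FF; first by exists [::] => // y [].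
  have h : 0 < 1 / 2 :> R by lra.
  have [||y [[Ay ny] Hy]] := cp (A `\` arcs [:: p]) [set y | A y -> arcs [:: p] y].
  - by exists [:: p] => // y; rewrite inE => /eqP->.
  - have : nbhs (e p 0) _ := arc_opn (eP Ap) (I0 p) h; rewrite (arc0 (eP Ap)).
    apply: filterS => y Hy /Hy[s [Is]]; rewrite subr0 ltr_norml => sh ->.
    by exists p; [rewrite mem_head|exists s].
  - by apply: ny; exact: Hy.
have [_ [l0 l0A Hbal]] := balanced_arcs Axs.
have AE : arcs xs = A.
  apply/seteqP; split => // y [x xx]; apply: arc_sub; exact: Axs.
rewrite AE in Hbal.
pose m := undup (l0 ++ l).
have mA y : y \in m -> A y.
  by rewrite mem_undup mem_cat => /orP[/l0A//|/lP[]].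
have := Hbal m (undup_uniq _).
rewrite (eq_big_seq bd); last by move=> y /mA; exact: jmp_all.
have sum_odd (s : seq W) : \big[addb/false]_(y <- s) bd y = odd (count bd s).
  by elim: s => [|y s IHs]; rewrite ?big_nil// big_cons IHs/= oddD; case: (bd y).
rewrite sum_odd -size_filter.
have -> : size [seq x <- m | bd x] = size l.
  apply: perm_size; apply: uniq_perm => //; first by rewrite filter_uniq ?undup_uniq.
  move=> y; rewrite mem_filter mem_undup mem_cat; apply/andP/idP.
    by move=> [by_ /orP[/l0A Ay|//]]; apply/lP.
  by move=> yl; have /lP[_ ->] := yl; rewrite yl orbT.
move=> -> // y yl0; by rewrite mem_undup mem_cat yl0.
Qed.

End OneManifold.

(** * Fixed points of smooth actions *)

Section Isotropy.
Variables (R : realType) (k n : nat) (H : set 'rV[R]_n).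

Section Charts.
Variable M : compact_manifold H.
Implicit Types (c d : chart R n M) (x : M).

Lemma chart_inv c x : atlas c -> cdom c x ->
  \forall y \near cmap c x, H y -> cdom c (cinv c y) /\ cmap c (cinv c y) = y.
Proof.
move=> /atlas_chart[_ [Q oQ QE] cK _ _] cx.
have Qx : Q (cmap c x).
  by have [] : (Q `&` H) (cmap c x) by rewrite -QE; exists x.
have : nbhs (cmap c x) Q by exact: open_nbhs_nbhs.
apply: filterS => y Qy Hy.
have [z cz <-] : (cmap c @` cdom c) y by rewrite QE.
by rewrite cK.
Qed.

Lemma chart_inv_cvg c x V : atlas c -> cdom c x -> nbhs x V ->
  \forall y \near cmap c x, H y -> V (cinv c y).
Proof.
move=> ac cx xV; have [_ _ cK _ cc] := atlas_chart ac.
have xi : (cmap c @` cdom c) (cmap c x) by exists x.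
have /subspace_continuousP/(_ _ xi) := cc.
rewrite /from_subspace (cK _ cx).
move=> /(_ V xV); rewrite /fmap/= => ccx.
apply: filterS (filterI (chart_inv ac cx) ccx) => y [h1 h2] Hy.
by apply: h2; have [h3 h4] := h1 Hy; exists (cinv c y).
Qed.

Lemma chart_cvg c x V : atlas c -> cdom c x -> nbhs (cmap c x) V ->
  \forall z \near x, cdom c z /\ V (cmap c z).
Proof.
move=> ac cx xV; have [oc _ _ cc _] := atlas_chart ac.
have /subspace_continuousP/(_ _ cx)/(_ V xV) := cc; rewrite /from_subspace /fmap/= => ccx.
have : nbhs x (cdom c) by exact: open_nbhs_nbhs.
by move=> h; apply: filterS (filterI h ccx) => z [cz hz]; split => //; exact: hz.
Qed.

Lemma chart_range c x : atlas c -> cdom c x -> H (cmap c x).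
Proof.
move=> /atlas_chart[_ [Q _ QE] _ _ _] cx.
by have [] : (Q `&` H) (cmap c x) by rewrite -QE; exists x.
Qed.

Lemma chart_K c x : atlas c -> cdom c x -> cinv c (cmap c x) = x.
Proof. by move=> /atlas_chart[_ _ + _ _] cx; apply. Qed.

End Charts.

(** The derivative of a smooth map in charts; the representative is used at the
    points of [H] only. *)
Lemma smooth_map_sd p (K : set 'rV[R]_p) (M : compact_manifold H)
    (N : compact_manifold K) (f : M -> N) c d x :
  smooth_map setT f -> atlas c -> atlas d -> cdom c x -> cdom d (f x) ->
  exists L, sd H (cmap d \o f \o cinv c) (cmap c x) L.
Proof.
move=> [cf sf] ac ad cx dfx.
have [|L sL] := @smooth_sd _ _ _ _ _ (cmap c x) (sf _ _ ac ad); first by exists x.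
exists L; apply: (sd_germ sL).
have fd : nbhs x (f @^-1` cdom d).
  have h := (continuous_subspace_setT f).2 cf x.
  apply: (h (cdom d)); apply: open_nbhs_nbhs; split => //.
  by have [] := atlas_chart ad.
apply: filterS (filterI (chart_inv ac cx) (chart_inv_cvg ac cx fd)).
move=> y [h1 h2] Hy; have [h3 h4] := h1 Hy; split => //.
by exists (cinv c y) => //; split; [split|exact: h2].
Qed.

(** In each coordinate direction [H] contains short segments; this makes the
    derivatives unique. *)
Hypothesis fatH : forall (x : 'rV[R]_n) i, H x ->
  \forall t \near 0^'+, H (x + t *: delta_mx 0 i).

Lemma sd_uniq_fat p (F : 'rV[R]_n -> 'rV[R]_p) x L L' :
  H x -> sd H F x L -> sd H F x L' -> L = L'.
Proof.
move=> Hx s s'; apply/row_matrixP => i; rewrite !rowE.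
exact: (sd_uniq Hx s s' (fatH i Hx)).
Qed.

Variables (M : compact_manifold H) (a : smooth_action k M).
Local Notation G := 'rV['F_2]_k.
Implicit Types (c d : chart R n M) (x : M) (g h : G).

(** The fixed points on a manifold that may have a boundary. *)
Definition fixed x := forall g, a g x = x.

Definition local_act c g : 'rV[R]_n -> 'rV[R]_n := cmap c \o a g \o cinv c.

(** The isotropy representation at a fixed point, read in a chart. *)
Definition isotropy c x (L : G -> 'M[R]_n) :=
  forall g, sd H (local_act c g) (cmap c x) (L g).

(** The projection onto the vectors fixed by the representation. *)
Definition avg (L : G -> 'M[R]_n) : 'M[R]_n :=
  #|{: G}|%:R^-1 *: \sum_g L g.

Lemma act_cvg g x V : nbhs (a g x) V -> \forall z \near x, V (a g z).
Proof.
have [ca _] := act_smooth a g; move=> xV.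
exact: ((continuous_subspace_setT _).2 ca x V xV).
Qed.

Lemma isotropy_exists c x : atlas c -> cdom c x -> fixed x ->
  exists L, isotropy c x L.
Proof.
move=> ac cx fx.
suff /choice[L HL] : forall g, exists L, sd H (local_act c g) (cmap c x) L.
  by exists L.
by move=> g; apply: (smooth_map_sd (act_smooth a g)) => //; rewrite fx.
Qed.

Lemma local_act_near c x g : atlas c -> cdom c x -> fixed x ->
  \forall y \near cmap c x, H y ->
    [/\ cdom c (cinv c y), cmap c (cinv c y) = y, cdom c (a g (cinv c y)),
        H (local_act c g y) & cinv c (local_act c g y) = a g (cinv c y)].
Proof.
move=> ac cx fx.
have xV : nbhs x [set z | cdom c (a g z)].
  apply: act_cvg; rewrite fx; apply: open_nbhs_nbhs; split => //.
  by have [] := atlas_chart ac.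
apply: filterS (filterI (chart_inv ac cx) (chart_inv_cvg ac cx xV)) => y.
move=> [h1 h2] Hy; have [h3 h4] := h1 Hy; have h5 := h2 Hy.
split => //; first exact: chart_range.
exact: chart_K.
Qed.

Lemma local_act_fixed c x g : atlas c -> cdom c x -> fixed x ->
  local_act c g (cmap c x) = cmap c x.
Proof. by move=> ac cx fx; rewrite /local_act/= chart_K ?fx. Qed.

Let avg_cst p q (B : 'M[R]_(p, q)) : #|{: G}|%:R^-1 *: \sum_(g : G) B = B.
Proof.
rewrite sumr_const -[B *+ _]scaler_nat scalerA mulVf ?scale1r// pnatr_eq0 -lt0n.
by apply/card_gt0P; exists 0.
Qed.

Section AtFixedPoint.
Variables (c : chart R n M) (x : M) (L : G -> 'M[R]_n).
Hypotheses (ac : atlas c) (cx : cdom c x) (fx : fixed x) (Lx : isotropy c x L).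

Let Hx : H (cmap c x). Proof. exact: chart_range. Qed.

Lemma isotropy0 : L 0 = 1%:M.
Proof.
apply: (sd_uniq_fat Hx (Lx 0)); apply: (sd_germ (@sd_id _ _ H _)).
apply: filterS (local_act_near 0 ac cx fx) => y h Hy; have [_ yE _ _ _] := h Hy.
by rewrite /local_act/= act0.
Qed.

Lemma isotropyD g h : L (g + h) = L h *m L g.
Proof.
apply: (sd_uniq_fat Hx (Lx (g + h))).
have Lg : sd H (local_act c g) (local_act c h (cmap c x)) (L g).
  by rewrite local_act_fixed.
apply: (sd_germ (sd_comp Hx (Lx h) Lg _)).
  by apply: filterS (local_act_near h ac cx fx) => y H1 Hy; have [] := H1 Hy.
apply: filterS (local_act_near h ac cx fx) => y H1 Hy; have [_ _ _ _ E] := H1 Hy.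
by split => //; rewrite /= {1}/local_act/= E -actD.
Qed.

Lemma isotropy_avg g : L g *m avg L = avg L /\ avg L *m L g = avg L.
Proof.
rewrite /avg -scalemxAr -scalemxAl mulmx_sumr mulmx_suml; split; congr (_ *: _).
  rewrite [RHS](reindex_inj (addIr g))/=.
  by apply: eq_bigr => h _; rewrite isotropyD.
rewrite [RHS](reindex_inj (addrI g))/=.
by apply: eq_bigr => h _; rewrite isotropyD.
Qed.

Lemma avg_idem : avg L *m avg L = avg L.
Proof.
rewrite {1}/avg -scalemxAl mulmx_suml.
rewrite (eq_bigr (fun=> avg L)) => [|g _]; last by have [] := isotropy_avg g.
exact: avg_cst.
Qed.

Lemma avg_fixed (u : 'rV[R]_n) : u *m avg L = u <-> forall g, u *m L g = u.
Proof.
split=> [uP g|uL].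
  by rewrite -uP -mulmxA; have [_ ->] := isotropy_avg g.
rewrite /avg -scalemxAr mulmx_sumr (eq_bigr (fun=> u)) => [|g _]; last exact: uL.
exact: avg_cst.
Qed.

(** Averaging the chart over the group: near [x], [linearize] conjugates the
    action to its derivative. *)
Definition linearize (y : 'rV[R]_n) : 'rV[R]_n :=
  \sum_g local_act c g y *m (#|{: G}|%:R^-1 *: L (- g)).

Lemma linearize_sd : sd H linearize (cmap c x) 1%:M.
Proof.
have -> : 1%:M = \sum_g L g *m (#|{: G}|%:R^-1 *: L (- g)).
  rewrite (eq_bigr (fun=> #|{: G}|%:R^-1 *: 1%:M)) => [|g _].
    by rewrite -scaler_sumr avg_cst.
  by rewrite -scalemxAr -isotropyD addNr isotropy0.
by apply: sd_sum => g; apply: sd_mulmxr; exact: Lx.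
Qed.

Lemma linearize_act h : \forall y \near cmap c x, H y ->
  linearize (local_act c h y) = linearize y *m L h.
Proof.
apply: filterS (local_act_near h ac cx fx) => y H1 Hy; have [_ _ _ _ E] := H1 Hy.
rewrite /linearize mulmx_suml [RHS](reindex_inj (addIr h))/=.
apply: eq_bigr => g _; rewrite {1}/local_act/= E -actD -mulmxA; congr (_ *m _).
rewrite -scalemxAl -isotropyD; congr (_ *: L _).
by rewrite opprD addrCA subrr addr0.
Qed.

End AtFixedPoint.

(** This turns the dimension of the fixed vectors into a continuous function of
    the representation. *)
Lemma idempotent_trace m (P : 'M[R]_m) : P *m P = P -> \tr P = (\rank P)%:R.
Proof.
move=> PP; have RC : row_base P *m col_base P = 1%:M.
  have h : col_base P *m (row_base P *m col_base P) *m row_base P =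
      col_base P *m 1%:M *m row_base P.
    rewrite mulmx1 mulmxA -mulmxA !mulmx_base //.
  have h2 := row_free_inj (row_base_free P) h.
  exact: (row_full_inj (col_base_full P) h2).
by rewrite -{1}(mulmx_base P) mxtrace_mulC RC mxtrace_scalar.
Qed.

(** The rank of [avg L] is the dimension of the fixed point set at [x]; two charts
    give conjugate representations. *)
Lemma rank_avg_chart c d x L L' : atlas c -> atlas d -> cdom c x ->
  cdom d x -> fixed x -> isotropy c x L -> isotropy d x L' ->
  \rank (avg L) = \rank (avg L').
Proof.
move=> ac ad cx dx fx Lx L'x.
have sid : smooth_map setT (@id M).
  split; first by apply: (continuous_subspace_setT id).1 => z; exact: cvg_id.
  move=> c' d' ac' ad'.
  have := atlas_smooth ac' ad'; rewrite /smooth_transition.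
  rewrite (_ : setT `&` _ `&` _ = cdom c' `&` cdom d'); first by [].
  by rewrite setTI.
have [T sT] := smooth_map_sd sid ac ad cx dx.
have [T' sT'] := smooth_map_sd sid ad ac dx cx.
have Hcx := chart_range ac cx; have Hdx := chart_range ad dx.
have cd c1 d1 : atlas c1 -> atlas d1 -> cdom c1 x -> cdom d1 x ->
    \forall y \near cmap c1 x, H y ->
      [/\ cdom c1 (cinv c1 y), cmap c1 (cinv c1 y) = y, cdom d1 (cinv c1 y) &
          H (cmap d1 (cinv c1 y))].
  move=> ac1 ad1 cx1 dx1.
  have dV : nbhs x (cdom d1).
    by apply: open_nbhs_nbhs; split => //; have [] := atlas_chart ad1.
  apply: filterS (filterI (chart_inv ac1 cx1) (chart_inv_cvg ac1 cx1 dV)).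
  move=> y [h1 h2] Hy; have [h3 h4] := h1 Hy; have h5 := h2 Hy.
  by split => //; exact: chart_range.
have TT' : T *m T' = 1%:M.
  apply: (sd_uniq_fat Hcx _ (@sd_id _ _ H _)).
  have sT2 : sd H (cmap c \o id \o cinv d) ((cmap d \o id \o cinv c) (cmap c x)) T'.
    by rewrite /= chart_K.
  apply: (sd_germ (sd_comp Hcx sT sT2 _)).
    by apply: filterS (cd _ _ ac ad cx dx) => y h Hy; have [] := h Hy.
  apply: filterS (cd _ _ ac ad cx dx) => y h Hy; have [h1 h2 h3 h4] := h Hy.
  by split => //=; rewrite (chart_K ad h3).
have LT g : T *m L' g = L g *m T.
  have s1 : sd H (local_act d g) ((cmap d \o id \o cinv c) (cmap c x)) (L' g).
    by rewrite /= chart_K.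
  have s2 : sd H (cmap d \o id \o cinv c) (local_act c g (cmap c x)) T.
    by rewrite local_act_fixed.
  apply: (sd_uniq_fat Hcx (sd_comp Hcx sT s1 _)).
    by apply: filterS (cd _ _ ac ad cx dx) => y h Hy; have [] := h Hy.
  apply: (sd_germ (sd_comp Hcx (Lx g) s2 _)).
    by apply: filterS (local_act_near g ac cx fx) => y h Hy; have [] := h Hy.
  apply: filterS (filterI (local_act_near g ac cx fx) (cd _ _ ac ad cx dx)).
  move=> y [H1 H2] Hy; have [h1 h2 h3 h4 h5] := H1 Hy; have [_ _ h6 _] := H2 Hy.
  by split => //=; rewrite h5 /local_act/= (chart_K ad h6).
have uT : T \in unitmx by have [] := mulmx1_unit TT'.
have uT' : T' \in unitmx by have [] := mulmx1_unit TT'.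
have E : T *m avg L' = avg L *m T.
  rewrite /avg -scalemxAr -scalemxAl mulmx_sumr mulmx_suml.
  by congr (_ *: _); apply: eq_bigr => g _; exact: LT.
have -> : avg L' = T' *m (avg L *m T).
  by rewrite -E mulmxA (mulmx1C TT') mul1mx.
by rewrite (eqmxMfull _ _) ?row_full_unit// mxrankMfree// row_free_unit.
Qed.

(** Strict derivatives depend continuously on the point. *)
Lemma sd_close p (F : 'rV[R]_n -> 'rV[R]_p) (x : 'rV[R]_n) L eps :
  sd H F x L -> 0 < eps -> \forall z \near x, H z ->
    forall L', sd H F z L' -> forall i j, `|L' i j - L i j| <= eps.
Proof.
move=> sF eps0; have e20 : 0 < eps / 2 by rewrite divr_gt0.
have [dl dl0 Hdl] := sF _ e20.
apply/nbhs_ballP; exists dl => // z; rewrite -ball_normE/= distrC => zx Hz L' sF'.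
move=> i j; have [dl' dl'0 Hdl'] := sF' _ e20.
have : \forall t \near 0^'+, [/\ H (z + t *: delta_mx 0 i), 0 < t, t < dl' &
    t < dl - `|z - x|].
  near=> t; split; first by near: t; exact: fatH.
  - by near: t; exact: nbhs_right_gt.
  - by near: t; exact: nbhs_right_lt.
  - by near: t; apply: nbhs_right_lt; rewrite subr_gt0.
move=> /filter_ex[t [Ht t0 t1 t2]].
have nt : `|t *: delta_mx 0 i : 'rV[R]_n| = t.
  by rewrite normZ norm_delta mulr1 gtr0_norm.
have tz : z + t *: delta_mx 0 i - z = t *: delta_mx 0 i by rewrite addrC addKr.
have := Hdl' _ _ Ht Hz; rewrite tz nt subrr normr0 => /(_ t1 dl'0) h1.
have := Hdl _ _ Ht Hz; rewrite tz nt => /(_ _ zx) h2.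
have {}h2 := h2 _.
have tx : `|z + t *: delta_mx 0 i - x| < dl.
  rewrite addrAC (le_lt_trans (ler_normD _ _))// nt; lra.
have {tx} h2 := h2 tx.
rewrite -(ler_pM2l t0) -{1}(gtr0_norm t0) -normrM.
have e1 : t * (L' i j - L i j) =
    (F (z + t *: delta_mx 0 i) - F z - t *: delta_mx 0 i *m L) 0 j -
    (F (z + t *: delta_mx 0 i) - F z - t *: delta_mx 0 i *m L') 0 j.
  rewrite -!scalemxAl -!rowE !mxE; ring.
rewrite e1 (le_trans (ler_normB _ _))//.
apply: (le_trans (lerD (le_trans (norm_entry _ j) h2) (le_trans (norm_entry _ j) h1))).
by rewrite -mulrDl -splitr mulrC.
Unshelve. all: by end_near. Qed.

(** A dimension that varies continuously is locally constant. *)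
Lemma rank_avg_near c x L : atlas c -> cdom c x -> fixed x -> isotropy c x L ->
  \forall z \near x, fixed z -> cdom c z /\ (forall L', isotropy c z L' ->
    \rank (avg L') = \rank (avg L)).
Proof.
move=> ac cx fx Lx; pose eps : R := n.+1%:R^-1.
have eps0 : 0 < eps by rewrite invr_gt0 ltr0n.
have cl : \forall y \near cmap c x, forall g, H y ->
    forall L', sd H (local_act c g) y L' -> forall i j, `|L' i j - L g i j| <= eps.
  apply: (@filter_forall _ _ (fun (g : G) (y : 'rV[R]_n) => H y -> forall L',
    sd H (local_act c g) y L' -> forall i j, `|L' i j - L g i j| <= eps)
    (nbhs (cmap c x))) => g.
  exact: sd_close (Lx g) eps0.
apply: filterS (chart_cvg ac cx cl) => z [cz {}cl] fz; split => // L' L'z.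
have Hz := chart_range ac cz.
have entry i : `|avg L' i i - avg L i i| <= eps.
  rewrite !mxE -mulrBr !summxE -sumrB normrM ger0_norm ?invr_ge0//.
  rewrite ler_pdivrMl ?ltr0n; last by apply/card_gt0P; exists 0.
  apply: (le_trans (ler_norm_sum _ _ _)).
  apply: (@le_trans _ _ (\sum_(g : G) eps)); last by rewrite sumr_const mulr_natl.
  by apply: ler_sum => g _; exact: cl.
have : `|\tr (avg L') - \tr (avg L)| < 1.
  rewrite -sumrB (le_lt_trans (ler_norm_sum _ _ _))//.
  apply: (@le_lt_trans _ _ (\sum_(i < n) eps)); first by apply: ler_sum => i _.
  by rewrite sumr_const card_ord -mulr_natl ltr_pdivrMr ?ltr0n// mul1r ltr_nat.
(* both traces are natural numbers *)
rewrite (idempotent_trace (avg_idem ac cx fx Lx)).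
rewrite (idempotent_trace (avg_idem ac cz fz L'z)).
move: (\rank _) (\rank _) => r' r; rewrite ltr_norml => /andP[h1 h2].
have r1 : (r < r'.+1)%N by rewrite -(ltr_nat R) -natr1; lra.
have r2 : (r' < r.+1)%N by rewrite -(ltr_nat R) -natr1; lra.
by apply/eqP; rewrite eqn_leq; apply/andP; split; rewrite -ltnS.
Qed.

Definition curve_part : set M := [set x | fixed x /\ exists c L,
  [/\ atlas c, cdom c x, isotropy c x L & \rank (avg L) = 1]].

Lemma curve_partP c x L : atlas c -> cdom c x -> fixed x -> isotropy c x L ->
  curve_part x <-> \rank (avg L) = 1.
Proof.
move=> ac cx fx Lx; split=> [[_ [d [L' [ad dx L'x <-]]]]|r1].
  exact: (rank_avg_chart ac ad cx dx fx).
by split => //; exists c, L.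
Qed.

Lemma curve_part_near x : fixed x ->
  \forall z \near x, fixed z -> (curve_part z <-> curve_part x).
Proof.
move=> fx; have [c ac cx] := atlas_cover x.
have [L Lx] := isotropy_exists ac cx fx.
apply: filterS (rank_avg_near ac cx fx Lx) => z hz fz.
have [cz {}hz] := hz fz; have [L' L'z] := isotropy_exists ac cz fz.
rewrite (curve_partP ac cz fz L'z) (curve_partP ac cx fx Lx).
by rewrite (hz _ L'z).
Qed.

(** The one-dimensional part is closed, because the dimension is locally
    constant on the fixed point set. *)
Lemma curve_part_compact : compact curve_part.
Proof.
apply: (subclosed_compact _ (@mcompact _ _ _ M)) => // x cl.
have fx : fixed x.
  move=> g; apply: contrapT => /eqP ne.
  have := @mhausdorff _ _ _ M; rewrite open_hausdorff => /(_ _ _ ne).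
  move=> [[U V] /= [/set_mem xU /set_mem xV] [oU oV UV]].
  have nU : nbhs (a g x) U by exact: open_nbhs_nbhs.
  have nV : nbhs x V by exact: open_nbhs_nbhs.
  have [z [[fz _] [Vz Uz]]] := cl _ (filterI nV (act_cvg nU)).
  have : (U `&` V) z by split => //; rewrite -(fz g).
  by move/eqP: UV => ->.
have [z [Az]] := cl _ (curve_part_near fx).
by move=> hz; apply/(hz _).1 => //; case: Az.
Qed.

End Isotropy.

(** * The one-dimensional part of the fixed point set *)

Section Curve.
Variables (R : realType) (k n : nat) (W : manifold_with_boundary R n).
Variable a : smooth_action k W.
Local Notation H := (@half_space R n).
Local Notation G := 'rV['F_2]_k.

Lemma half_space_fat (x : 'rV[R]_n.+1) i : H x ->
  \forall t \near 0^'+, H (x + t *: delta_mx 0 i).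
Proof.
move=> Hx; near=> t; rewrite /half_space/= !mxE eqxx/=.
have t0 : 0 < t by near: t; exact: nbhs_right_gt.
by rewrite addr_ge0// mulr_ge0 ?ler0n// ltW.
Unshelve. all: by end_near. Qed.

Let fat := half_space_fat.

(** In the linearizing coordinates, the fixed points near [x] are the points of
    the line directed by [v]; at a boundary point, [v] points inwards and only
    half of this line is in the half-space. *)
Lemma fixed_arc c (x : W) L (v : 'rV[R]_n.+1) (l : 'cV[R]_n.+1) (A : set W) :
  atlas c -> cdom c x -> fixed a x -> isotropy a c x L ->
  v != 0 -> v *m avg L = v ->
  (forall u : 'rV[R]_n.+1, u *m avg L = u -> u = (u *m l) 0 0 *: v) ->
  (cmap c x 0 ord0 = 0 -> 0 < v 0 ord0) ->
  (forall y, A y -> fixed a y) -> (\forall y \near x, fixed a y -> A y) ->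
  exists e : R -> W, arc_chart A (cmap c x 0 ord0 == 0) x e.
Proof.
move=> ac cx fx Lx v0 vP uP xv Af nA.
have Hx := chart_range ac cx.
set X := cmap c x in Hx xv *; set phi := linearize a c L.
have nv : 0 < `|v| by rewrite normr_gt0.
have vL g : v *m L g = v by have [+ _] := avg_fixed fat ac cx fx Lx v; apply.
have [r0 [r00 half pos surj]] :=
  half_space_curve Hx (linearize_sd fat ac cx fx Lx) v0 xv.
rewrite -/phi in half pos surj.
(* Near [x], everything that will be needed holds in the chart. *)
have good : \forall y \near X, forall g : G, H y ->
    [/\ cdom c (cinv c y), cmap c (cinv c y) = y,
        H (local_act a c g y), cinv c (local_act a c g y) = a g (cinv c y) &
        phi (local_act a c g y) = phi y *m L g] /\
    (`|local_act a c g y - X| < r0 /\ (fixed a (cinv c y) -> A (cinv c y))).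
  apply: (@filter_forall _ _ (fun (g : G) (y : 'rV[R]_n.+1) => H y ->
    [/\ cdom c (cinv c y), cmap c (cinv c y) = y,
        H (local_act a c g y), cinv c (local_act a c g y) = a g (cinv c y) &
        phi (local_act a c g y) = phi y *m L g] /\
    (`|local_act a c g y - X| < r0 /\ (fixed a (cinv c y) -> A (cinv c y))))
    (nbhs X)) => g.
  have nr : \forall y \near X, H y -> `|local_act a c g y - X| < r0.
    have := sd_cvg Hx (Lx g) r00; rewrite local_act_fixed//.
  apply: filterS (filterI (filterI (local_act_near g ac cx fx)
    (linearize_act fat ac cx fx Lx g)) (filterI nr (chart_inv_cvg ac cx nA))).
  move=> y [[h1 h2] [h3 h4]] Hy; have [h5 h6 _ h7 h8] := h1 Hy.
  by split; [split => //; exact: h2|split; [exact: h3|exact: h4]].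
have /nbhs_ballP[r1 r10 Hr1] := good.
pose r := Num.min r0 r1.
have r_gt0 : 0 < r by rewrite lt_min r00.
have rr0 : r <= r0 by rewrite ge_min lexx.
have {good Hr1} good y : `|y - X| < r -> H y -> forall g : G,
    [/\ cdom c (cinv c y), cmap c (cinv c y) = y,
        H (local_act a c g y), cinv c (local_act a c g y) = a g (cinv c y) &
        phi (local_act a c g y) = phi y *m L g] /\
    (`|local_act a c g y - X| < r0 /\ (fixed a (cinv c y) -> A (cinv c y))).
  move=> yX Hy g; apply: Hr1 => //; rewrite -ball_normE/= distrC.
  by rewrite (lt_le_trans yX)// ge_min lexx orbT.
have XX : `|X - X| < r by rewrite subrr normr0.
have phiX g : phi X *m L g = phi X.
  have [[_ _ _ _ <-] _] := good X XX Hx g.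
  by rewrite local_act_fixed.
have rl y : `|y - X| < r -> `|y - X| < r0 by move=> h; exact: lt_le_trans h rr0.
have inj y z : H y -> H z -> `|y - X| < r0 -> `|z - X| < r0 -> phi y = phi z -> y = z.
  move=> Hy Hz yX zX yz; have := half _ _ Hy Hz yX zX.
  rewrite yz subrr sub0r normrN => h; apply/eqP; rewrite -subr_eq0 -normr_le0.
  by move: h; set b := `|_|; lra.
have [dl dl0 Hdl] : exists2 dl, 0 < dl & forall t, `|t| < dl ->
      (X 0 ord0 = 0 -> 0 <= t) ->
      exists y, [/\ H y, `|y - X| < r & phi y = phi X + t *: v].
  by apply: surj; rewrite r_gt0.
pose I := @arc_domain R (X 0 ord0 == 0).
have Idl t : I t -> `|dl * t| < dl /\ (X 0 ord0 = 0 -> 0 <= dl * t).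
  move=> [/andP[t1 t2] bt]; split.
    by rewrite normrM gtr0_norm// gtr_pMr// ltr_norml t1.
  by move/eqP/bt => t0; rewrite mulr_ge0// ltW.
have /choice[E HE] : forall t, exists y, I t ->
    [/\ H y, `|y - X| < r & phi y = phi X + (dl * t) *: v].
  move=> t; have [It|nI] := pselect (I t); last by exists X.
  by have [h1 h2] := Idl _ It; have [y hy] := Hdl _ h1 h2; exists y.
have Efixed t : I t -> fixed a (cinv c (E t)).
  move=> It g; have [Hy yX yt] := HE _ It.
  have [[_ _ h3 <- h5] [h6 _]] := good _ yX Hy g.
  congr (cinv c _); apply: inj => //; first exact: rl.
  by rewrite h5 yt mulmxDl phiX -scalemxAl vL.
have EA t : I t -> A (cinv c (E t)).
  move=> It; have [Hy yX yt] := HE _ It; have [_ [_]] := good _ yX Hy 0.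
  by apply; exact: Efixed.
have Edist s t : I s -> I t -> `|E s - E t| <= 2 * (dl * `|s - t| * `|v|).
  move=> Is It; have [Hs sX sE] := HE _ Is; have [Ht tX tE] := HE _ It.
  have := half _ _ Hs Ht (rl _ sX) (rl _ tX); rewrite sE tE.
  have -> : phi X + (dl * s) *: v - (phi X + (dl * t) *: v) = (dl * (s - t)) *: v.
    by apply/rowP => i; rewrite !mxE; ring.
  have := ler_normB ((dl * (s - t)) *: v) ((dl * (s - t)) *: v - (E s - E t)).
  rewrite subKr normZ normrM (gtr0_norm dl0).
  set p := `|E s - E t|; set q := dl * _ * _; set w := `|_ *: v - _|; lra.
exists (fun t => cinv c (E t)); split.
- have I0 : I 0 by split => //; apply/andP; split; lra.
  have [Hy yX] := HE _ I0; rewrite mulr0 scale0r addr0 => yE.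
  by rewrite (inj _ _ Hy Hx (rl _ yX) (rl _ XX) yE) chart_K.
- exact: EA.
- move=> s t Is It st; have [Hs sX sE] := HE _ Is; have [Ht tX tE] := HE _ It.
  have [[_ es _ _ _] _] := good _ sX Hs 0; have [[_ et _ _ _] _] := good _ tX Ht 0.
  have {}st : E s = E t by rewrite -es st et.
  have : (dl * s) *: v == (dl * t) *: v.
    by rewrite -(inj_eq (addrI (phi X))) -sE st tE.
  rewrite -subr_eq0 -scalerBl scaler_eq0 (negbTE v0) orbF -mulrBr mulf_eq0.
  by rewrite gt_eqF//= subr_eq0 => /eqP.
- (* [E] is Lipschitz *)
  move=> t It V xV; have [Ht tX tE] := HE _ It.
  have [[h1 h2 _ _ _] _] := good _ tX Ht 0.
  have := chart_inv_cvg ac h1 xV; rewrite h2 => /nbhs_ballP[m m0 Hm].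
  exists (m / (2 * (dl * `|v|))) => [|s Is st].
    by rewrite divr_gt0// !mulr_gt0.
  have [Hs _ _] := HE _ Is; apply: Hm => //; rewrite -ball_normE/= distrC.
  apply: (le_lt_trans (Edist _ _ Is It)).
  move: st; rewrite ltr_pdivlMr ?mulr_gt0//; congr (_ < _); ring.
(* A fixed point [y] near the arc is linearized to a multiple of [v]; this
   multiple is the time at which the arc passes through [y]. *)
move=> t d It d0; have [Ht tX tE] := HE _ It.
have [[h1 h2 _ _ _] _] := good _ tX Ht 0.
have [/andP[t1 t2] bt] := It.
pose m := Num.min d (1 - `|t|).
have m0 : 0 < m by rewrite lt_min d0 subr_gt0 ltr_norml t1.
pose eta := Num.min (r - `|E t - X|) (m * dl * `|v| / 2).
have eta0 : 0 < eta by rewrite lt_min subr_gt0 tX !(divr_gt0, mulr_gt0).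
have := chart_cvg ac h1 (nbhsx_ballx _ _ eta0); rewrite h2; apply: filterS => y [cy].
rewrite -ball_normE/= distrC => ye Ay; have Hy := chart_range ac cy.
have yX : `|cmap c y - X| < r.
  have : `|cmap c y - E t| < r - `|E t - X|.
    by apply: (lt_le_trans ye); rewrite ge_min lexx.
  have := ler_normD (cmap c y - E t) (E t - X); rewrite addrA subrK; lra.
pose u := phi (cmap c y) - phi X.
have uv : u = (u *m l) 0 0 *: v.
  apply/uP/(avg_fixed fat ac cx fx Lx) => g.
  have [[_ _ _ _ h] _] := good _ yX Hy g.
  rewrite /u mulmxBl phiX -h /local_act/= chart_K// (Af _ Ay g)//.
pose s := (u *m l) 0 0 / dl.
have su : phi (cmap c y) = phi X + (dl * s) *: v.
  by rewrite /s mulrC divfK ?gt_eqF// -uv /u addrC subrK.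
have st : `|s - t| < m.
  have := half _ _ Hy Ht (rl _ yX) (rl _ tX); rewrite su tE.
  have -> : phi X + (dl * s) *: v - (phi X + (dl * t) *: v) = (dl * (s - t)) *: v.
    by apply/rowP => i; rewrite !mxE; ring.
  have := ler_normD ((dl * (s - t)) *: v - (cmap c y - E t)) (cmap c y - E t).
  rewrite subrK normZ normrM (gtr0_norm dl0) => q1 q2.
  have q3 : `|cmap c y - E t| < m * dl * `|v| / 2.
    by apply: (lt_le_trans ye); rewrite ge_min lexx orbT.
  have q4 : 0 < dl * `|v| by rewrite mulr_gt0.
  rewrite -(ltr_pM2r q4).
  have e1 : `|s - t| * (dl * `|v|) = dl * `|s - t| * `|v| by ring.
  have e2 : m * (dl * `|v|) = m * dl * `|v| by ring.
  have q5 : 0 < m * dl * `|v| by rewrite !mulr_gt0.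
  rewrite e1 e2; move: q1 q2 q3 q5.
  set p := `|_ - (_ - _)|; set q := `|cmap c y - _|.
  by set w := dl * _ * _; set z := m * _ * _; lra.
have Is : I s.
  split.
    have : `|s - t| < 1 - `|t| by apply: (lt_le_trans st); rewrite ge_min lexx orbT.
    by have := ler_normD (s - t) t; rewrite subrK -ltr_norml; lra.
  move=> /eqP X0; have := pos X0 _ _ Hy (rl _ yX) su.
  by rewrite pmulr_rge0.
exists s; split => //; first by apply: (lt_le_trans st); rewrite ge_min lexx.
have [Hs sX sE] := HE _ Is.
rewrite (inj _ _ Hs Hy (rl _ sX) (rl _ yX)) ?chart_K//.
by rewrite sE su.
Qed.

End Curve.

(** * Isolated fixed points of a bounding action *)

Section LinePart.
Variables (R : realType) (n : nat) (P : 'M[R]_n).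
Hypothesis PP : P *m P = P.

Lemma rank1_line : \rank P = 1 -> exists (v : 'rV[R]_n) (l : 'cV[R]_n),
  [/\ v != 0, v *m P = v &
      forall u : 'rV[R]_n, u *m P = u -> u = (u *m l) 0 0 *: v].
Proof.
move=> r1; have [i vi] : exists i, row i P != 0.
  apply: contrapT => /forallNP N.
  suff P0 : P = 0 by rewrite P0 mxrank0 in r1.
  apply/row_matrixP => i; rewrite row0; apply/eqP.
  by have := N i; case: eqVneq.
have [j vj] := row_neq0 vi.
set v := row i P in vi vj *.
exists v, ((v 0 j)^-1 *: delta_mx j 0); split => //; first by rewrite /v -row_mul PP.
move=> u uP; have : (u <= v)%MS.
  have vP : (v <= P)%MS by exact: row_sub.
  have /eqmxP vPe : (v == P)%MS.
    by rewrite -mxrank_leqif_eq// r1 rank_rV vi.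
  by rewrite vPe -uP submxMl.
move=> /submxP[D uD].
have {uD} uD : u = D 0 0 *: v by rewrite uD {1}(mx11_scalar D) mul_scalar_mx.
rewrite {1}uD; congr (_ *: _); rewrite uD.
rewrite -scalemxAr -scalemxAl -colE [RHS]mxE [X in _ = _ * X]mxE.
by rewrite [X in _ = _ * (_ * X)]mxE; field.
Qed.

Lemma line_rank1 (v : 'rV[R]_n) : v != 0 -> v *m P = v ->
  (forall u : 'rV[R]_n, u *m P = u -> exists s, u = s *: v) -> \rank P = 1.
Proof.
move=> v0 vP uv; have /eqmxP -> : (P == v)%MS.
  apply/andP; split; last by rewrite -vP submxMl.
  apply/row_subP => i; have [|s ->] := uv (row i P); last exact: scalemx_sub.
  by rewrite -row_mul PP.
by rewrite rank_rV v0.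
Qed.

End LinePart.

Section Bounding.
Variables (R : realType) (k n : nat) (M : closed_manifold R n).
Variables (Phi : smooth_action k M) (W : manifold_with_boundary R n).
Variables (b : smooth_action k W) (f : M -> W) (g : W -> M).
Hypotheses (sf : smooth_map setT f) (sg : smooth_map (@boundary R n W) g).
Hypotheses (fB : forall x, boundary (f x)) (fK : forall x, g (f x) = x).
Hypotheses (gK : forall y, boundary y -> f (g y) = y).
Hypothesis fE : forall h x, f (Phi h x) = b h (f x).

Local Notation H := (@half_space R n).
Local Notation G := 'rV['F_2]_k.

(** No nonzero tangent vector is fixed: the fixed point [m] is isolated. *)
Definition nondegenerate (m : M) := exists d L,
  [/\ atlas d, cdom d m, isotropy Phi d m L &
      forall u : 'rV[R]_n, (forall h, u *m L h = u) -> u = 0].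

Let fat := @half_space_fat R n.

Let b_boundary h y : boundary y -> boundary (b h y).
Proof. by move=> /gK <-; rewrite -fE. Qed.

Let g_act h y : boundary y -> g (b h y) = Phi h (g y).
Proof. by move=> /gK E; rewrite -{1}E -fE fK. Qed.

Section AtBoundary.
Variables (c : chart R n.+1 W) (m : M) (L : G -> 'M[R]_n.+1).
Hypotheses (ac : atlas c) (cx : cdom c (f m)) (c0 : cmap c (f m) 0 ord0 = 0).
Hypotheses (fm : fixed Phi m) (Lx : isotropy b c (f m) L) (nd : nondegenerate m).

Let X := cmap c (f m).
Let HX : H X. Proof. exact: chart_range. Qed.

Let fx : fixed b (f m).
Proof. by move=> h; rewrite -fE fm. Qed.

(** The action, read in a chart, maps the half-space to itself, hence so does its
    derivative. *)
Let isotropy_inward h : 0 <= L h ord0 ord0.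
Proof.
rewrite leNgt; apply/negP => l0; pose eps := - L h ord0 ord0 / 2.
have eps0 : 0 < eps by rewrite divr_gt0// oppr_gt0.
have [dl dl0 Hdl] := Lx h eps0.
have e0 : `|delta_mx 0 ord0 : 'rV[R]_n.+1| = 1 by rewrite norm_delta.
pose good (y : 'rV[R]_n.+1) := H y -> H (local_act b c h y).
have near1 : \forall t \near 0^'+, good (X + t *: delta_mx 0 ord0).
  apply: near_ray; apply: filterS (local_act_near h ac cx fx) => y hy Hy.
  by have [] := hy Hy.
have : \forall t \near 0^'+, [/\ 0 < t, t < dl, H (X + t *: delta_mx 0 ord0) &
    good (X + t *: delta_mx 0 ord0)].
  near=> t; split; near: t; [exact: nbhs_right_gt|exact: nbhs_right_lt|
    exact: (fat ord0 HX)|exact: near1].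
move=> /filter_ex[t [t0 tdl Ht /(_ Ht) Hlt]].
have := Hdl _ _ Ht HX; rewrite -/X addrAC subrr add0r normZ e0 mulr1 gtr0_norm//.
rewrite normr0 => /(_ tdl dl0) /(le_trans (norm_entry _ ord0)).
rewrite /X local_act_fixed// -scalemxAl -rowE !mxE c0 subr0 ler_norml => /andP[_].
move: Hlt; rewrite /half_space/= -/X; set w := local_act _ _ _ _ _ _.
have : 0 < - (t * L h ord0 ord0) by rewrite -mulrN mulr_gt0// oppr_gt0.
rewrite /eps => h1 h2 h3; have e1 : - L h ord0 ord0 / 2 * t = - (t * L h ord0 ord0) / 2 by field.
by move: h3; rewrite e1; lra.
Unshelve. all: by end_near. Qed.

(** A tangent vector of the boundary that is fixed by the action comes from a
    tangent vector of [M] that is fixed by the action. *)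
Let tangent_fixed (u : 'rV[R]_n.+1) : u 0 ord0 = 0 -> u *m avg L = u -> u = 0.
Proof.
move=> u0 /(avg_fixed fat ac cx fx Lx) uL.
have [d [S [ad dm Sm Sfix]]] := nd.
pose ga := cmap d \o g \o cinv c.
pose B := cmap c @` (@boundary R n W `&` cdom c `&` g @^-1` cdom d).
pose B0 := [set y : 'rV[R]_n.+1 | H y /\ y 0 ord0 = 0].
have gaX : ga X = cmap d m by rewrite /ga /X/= chart_K// fK.
have BX : B X by exists (f m) => //; split; [split|rewrite /= fK].
have [E sE] := smooth_sd (sg.2 _ _ ac ad) BX.
rewrite -/B -/ga in sE.
have dfm : cdom d (g (f m)) by rewrite fK.
have [F sF] := smooth_map_sd sf ad ac dm cx.
have B0X : B0 X by [].
have gV : nbhs (f m) [set z | boundary z -> cdom d (g z)].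
  have /subspace_continuousP/(_ _ (fB m)) := sg.1.
  rewrite /from_subspace fK => /(_ (cdom d)); apply.
  by apply: open_nbhs_nbhs; split => //; have [] := atlas_chart ad.
have nearB0 : \forall y \near X, B0 y -> [/\ cdom c (cinv c y),
    cmap c (cinv c y) = y, boundary (cinv c y) & cdom d (g (cinv c y))].
  apply: filterS (filterI (chart_inv ac cx) (chart_inv_cvg ac cx gV)).
  move=> y [h1 h2] [Hy y0]; have [h3 h4] := h1 Hy.
  have h5 : boundary (cinv c y) by exists c; split => //; rewrite h4.
  by split => //; exact: h2.
have ray : \forall t \near 0^'+, B0 (X + t *: u).
  apply: nearW => t; split; last by rewrite !mxE u0 mulr0 addr0.
  by rewrite /half_space/= !mxE u0 mulr0 addr0; exact: HX.
have sE0 : sd B0 ga X E.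
  apply: (sd_germ sE); apply: filterS nearB0 => y h By.
  have [h1 h2 h3 h4] := h By; split => //.
  by exists (cinv c y) => //; split.
(* [E] intertwines the two isotropy representations along the boundary *)
have uES h : u *m E = u *m E *m S h.
  rewrite -[in LHS](uL h) -!mulmxA.
  have nearh : \forall y \near X, B0 y -> [/\ cdom c (b h (cinv c y)),
     boundary (b h (cinv c y)), cdom d (g (b h (cinv c y))) &
     ga (local_act b c h y) = local_act Phi d h (ga y)].
    have gV' : nbhs (f m) [set z | boundary z -> cdom d (g (b h z))].
      have gVh : nbhs (b h (f m)) [set z | boundary z -> cdom d (g z)] by rewrite fx.
      by apply: filterS (act_cvg gVh) => z hz /(b_boundary h)/hz.
    apply: filterS (filterI nearB0 (filterI (local_act_near h ac cx fx)
      (chart_inv_cvg ac cx gV'))).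
    move=> y [h1 [h2 h3]] By; have [Hy _] := By.
    have [h4 h5 h6 h7] := h1 By; have [_ _ h8 _ h9] := h2 Hy.
    have h10 := h3 Hy h6; split => //; first exact: b_boundary.
    by rewrite /ga /local_act/= (chart_K ac h8) g_act// (chart_K ad h7).
  have sL0 : sd B0 (local_act b c h) X (L h).
    by apply: (sd_subset _ (Lx h)) => y [].
  have sEh : sd B ga (local_act b c h X) E by rewrite /X local_act_fixed.
  have sSh : sd setT (local_act Phi d h) (ga X) (S h) by rewrite gaX.
  apply: (@sd_uniq _ _ _ B0 (ga \o local_act b c h) X) => //.
    apply: (sd_comp B0X sL0 sEh); apply: filterS nearh => y hy By.
    have [h1 h2 h3 _] := hy By; exists (b h (cinv c y)) => //.
  apply: (sd_germ (sd_comp B0X sE0 sSh _)); first by apply: (@nearW _ (nbhs X)).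
  apply: filterS nearh => y hy By; have [_ _ _ h4] := hy By.
  by split => //=; rewrite h4.
have uE0 : u *m E = 0 by apply: Sfix => h; rewrite -uES.
have sFX : sd setT (cmap c \o f \o cinv d) (ga X) F by rewrite gaX.
have : u *m (E *m F) = u *m 1%:M.
  apply: (@sd_uniq _ _ _ B0 id X) => //; last exact: sd_id.
  apply: (sd_germ (sd_comp B0X sE0 sFX _)); first by apply: (@nearW _ (nbhs X)).
  apply: filterS nearB0 => y hy By; have [h1 h2 h3 h4] := hy By.
  by split => //=; rewrite (chart_K ad h4) gK.
by rewrite mulmxA uE0 mul0mx mulmx1.
Qed.

(** At a fixed point of the boundary, averaging an inward vector yields an inward
    fixed vector, and there is no fixed vector along the boundary: the fixed
    vectors form a line that is transverse to the boundary. *)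
Lemma boundary_line : exists (v : 'rV[R]_n.+1) (l : 'cV[R]_n.+1),
  [/\ 0 < v 0 ord0, v *m avg L = v &
      forall u : 'rV[R]_n.+1, u *m avg L = u -> u = (u *m l) 0 0 *: v].
Proof.
pose v := delta_mx 0 ord0 *m avg L : 'rV[R]_n.+1.
have v0 : 0 < v 0 ord0.
  rewrite /v -rowE !mxE mulr_gt0 ?invr_gt0 ?ltr0n//.
    by apply/card_gt0P; exists 0.
  rewrite summxE (bigD1 0)//= ltr_pwDl ?sumr_ge0//.
  by rewrite (isotropy0 fat ac cx fx Lx) mxE eqxx.
have vP : v *m avg L = v by rewrite /v -mulmxA (avg_idem fat ac cx fx Lx).
clearbody v; exists v, ((v 0 ord0)^-1 *: delta_mx ord0 0); split => // u uP.
rewrite -scalemxAr -colE !mxE; apply/eqP; rewrite -subr_eq0; apply/eqP.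
apply: tangent_fixed; first by rewrite !mxE; field; rewrite gt_eqF.
by rewrite mulmxBl uP -scalemxAl vP.
Qed.

End AtBoundary.

(** The one-dimensional part of the fixed point set of [W] is a compact
    one-dimensional manifold whose boundary points are the fixed points of [M]. *)
Theorem even_fixed_points (s : seq M) : uniq s ->
  (forall x, x \in s <-> fixed Phi x) -> (forall x, x \in s -> nondegenerate x) ->
  ~~ odd (size s).
Proof.
move=> us sP snd.
pose A := curve_part b; pose bd (x : W) : bool := `[< boundary x >].
have fixf m : fixed Phi m -> fixed b (f m) by move=> fm h; rewrite -fE fm.
have fixg y : boundary y -> fixed b y -> fixed Phi (g y).
  by move=> By fy h; rewrite -g_act// fy.
have bline y c L : boundary y -> fixed b y -> atlas c -> cdom c y ->
    cmap c y 0 ord0 = 0 -> isotropy b c y L ->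
    exists (v : 'rV[R]_n.+1) (l : 'cV[R]_n.+1), [/\ 0 < v 0 ord0, v *m avg L = v &
      forall u : 'rV[R]_n.+1, u *m avg L = u -> u = (u *m l) 0 0 *: v].
  move=> By; rewrite -(gK By) => fy ac cy y0 Ly.
  have fgy : fixed Phi (g y) by apply: fixg => //; rewrite -(gK By).
  by apply: (boundary_line ac cy y0 fgy Ly); apply/snd/sP.
have pos0 (v : 'rV[R]_n.+1) : 0 < v 0 ord0 -> v != 0.
  by apply: contraTneq => ->; rewrite mxE ltxx.
have nearA x : A x -> \forall y \near x, fixed b y -> A y.
  move=> Ax; have [fx _] := Ax.
  by apply: filterS (curve_part_near fat fx) => y hy fy; apply/(hy fy).
have /choice[e eP] : forall x, exists e : R -> W, A x -> arc_chart A (bd x) x e.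
  move=> x; have [Ax|nA] := pselect (A x); last by exists (fun=> x).
  have [fx _] := Ax.
  have Af y : A y -> fixed b y by case.
  (* By definition, a boundary point lies on the boundary in some chart, and
     this chart is used; the other points have a nonzero first coordinate in
     every chart. *)
  have [Bx|nB] := pselect (boundary x).
    have [c [ac cx c0]] := Bx.
    have [L Lx] := isotropy_exists ac cx fx.
    have [v [l [v0 vP uP]]] := bline _ _ _ Bx fx ac cx c0 Lx.
    have [e He] := fixed_arc ac cx fx Lx (pos0 _ v0) vP uP (fun=> v0) Af (nearA _ Ax).
    by exists e => _; rewrite /bd asboolT//; move: He; rewrite c0 eqxx.
  have [c ac cx] := atlas_cover x.
  have [L Lx] := isotropy_exists ac cx fx.
  have r1 := (curve_partP fat ac cx fx Lx).1 Ax.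
  have [v [l [v0 vP uP]]] := rank1_line (avg_idem fat ac cx fx Lx) r1.
  have xn0 : cmap c x 0 ord0 <> 0 by move=> c0; apply: nB; exists c.
  have [e He] := fixed_arc ac cx fx Lx v0 vP uP (fun c0 => False_ind _ (xn0 c0)) Af (nearA _ Ax).
  exists e => _; rewrite /bd asboolF//; move: He.
  by case: eqP.
rewrite -(size_map f).
apply: (@even_boundary _ _ A bd e (@mhausdorff _ _ _ W)
  (@curve_part_compact _ _ _ _ fat W b) eP (map f s)).
  by rewrite map_inj_uniq//; exact: can_inj fK.
move=> y; split.
  move=> /mapP[m /sP fm ->]; split; last exact/asboolP.
  have [c [ac cx c0]] := fB m; have fx := fixf _ fm.
  have [L Lx] := isotropy_exists ac cx fx.
  have [v [l [v0 vP uP]]] := bline _ _ _ (fB m) fx ac cx c0 Lx.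
  apply/(curve_partP fat ac cx fx Lx).
  apply: (line_rank1 (avg_idem fat ac cx fx Lx) (pos0 _ v0) vP) => u /uP ->.
  by eexists.
move=> [[fy _] /asboolP By]; rewrite -(gK By); apply: map_f; apply/sP.
exact: fixg.
Qed.

End Bounding.

(** * Calculus of functions of class C^k *)

Section CkCalculus.
Variables (R : realType) (n : nat) (U : set 'rV[R]_n).
Hypothesis oU : open U.
Implicit Types f g : 'rV[R]_n -> R.

Let nearU x : U x -> \forall y \near x, U y.
Proof. by move=> Ux; apply: open_nbhs_nbhs. Qed.

(** On an open set, equal functions have equal derivatives. *)
Lemma Ck_ext r f g : (forall x, U x -> f x = g x) -> Ck r U f -> Ck r U g.
Proof.
elim: r f g => [|r IH] f g fg [cf df].
  split => // x Ux; have fgx : \forall y \near x, f y = g y.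
    by apply: filterS (nearU Ux) => y /fg.
  have := cf _ Ux; rewrite /prop_for /continuous_at -(fg _ Ux); apply: cvg_trans.
  exact: near_eq_cvg fgx.
have fgx x : U x -> \forall y \near x, f y = g y.
  by move=> Ux; apply: filterS (nearU Ux) => y /fg.
split=> [x Ux|i].
  have := cf _ Ux; rewrite /prop_for /continuous_at -(fg _ Ux); apply: cvg_trans.
  exact: near_eq_cvg (fgx _ Ux).
have [di ci] := df i; split=> [x Ux|].
  exact: near_eq_derivable (fgx _ Ux) (di _ Ux).
by apply: IH ci => x Ux; exact: near_eq_derive (fgx _ Ux).
Qed.

Lemma CkS r f : Ck r.+1 U f -> Ck r U f.
Proof.
elim: r f => [|r IH] f [cf df]; first by [].
by split => // i; have [? ?] := df i; split => //; exact: IH.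
Qed.

Lemma Ck_cst r (a : R) : Ck r U (fun=> a).
Proof.
elim: r a => [|r IH] a; split => //; try by move=> x _; exact: cst_continuous.
move=> i; split => [x _|]; first exact: derivable_cst.
by apply: Ck_ext (IH 0) => x _; rewrite derive_cst.
Qed.

Lemma Ck_coord r (i : 'I_n) : Ck r U (fun x => x 0 i).
Proof.
have ci : continuous (fun x : 'rV[R]_n => x 0 i) by exact: coord_continuous.
case: r => [|r]; split => //; try by move=> x _; exact: ci.
move=> j.
have lin (x v : 'rV[R]_n) : (fun h : R => h^-1 *:
    (((fun y : 'rV[R]_n => y 0 i) \o shift x) (h *: v) - x 0 i)) @ 0^' --> v 0 i.
  apply: cvg_near_cst; near=> h; have h0 : h != 0 by near: h; exact: nbhs_dnbhs_neq.
  rewrite /= !mxE addrK -[_ *: _]/(_ * _) mulKf//.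
split=> [x _|]; first by apply/cvg_ex; eexists; exact: lin.
apply: Ck_ext (Ck_cst r ((delta_mx 0 j : 'rV[R]_n) 0 i)) => x _.
by apply/esym/cvg_lim => //; exact: lin.
Unshelve. all: by end_near. Qed.

Lemma CkD r f g : Ck r U f -> Ck r U g -> Ck r U (fun x => f x + g x).
Proof.
elim: r f g => [|r IH] f g [cf df] [cg dg]; split => //;
  try by move=> x Ux; exact: (continuousD (cf x Ux) (cg x Ux)).
move=> i; have [df1 df2] := df i; have [dg1 dg2] := dg i; split=> [x Ux|].
  by apply: derivableD; [exact: df1|exact: dg1].
by apply: Ck_ext (IH _ _ df2 dg2) => x Ux; rewrite -deriveD//; auto.
Qed.

Lemma CkM r f g : Ck r U f -> Ck r U g -> Ck r U (fun x => f x * g x).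
Proof.
elim: r f g => [|r IH] f g Hf Hg; have := Hf; have := Hg => -[cg dg] [cf df];
  split => //; try by move=> x Ux; exact: (continuousM (cf x Ux) (cg x Ux)).
move=> i; have [df1 df2] := df i; have [dg1 dg2] := dg i; split=> [x Ux|].
  by apply: derivableM; [exact: df1|exact: dg1].
apply: Ck_ext (CkD (IH _ _ (CkS Hf) dg2) (IH _ _ (CkS Hg) df2)) => x Ux.
exact/esym/(deriveM (df1 x Ux) (dg1 x Ux)).
Qed.

Lemma CkV r f : (forall x, U x -> f x != 0) -> Ck r U f ->
  Ck r U (fun x => (f x)^-1).
Proof.
move=> f0; elim: r => [|r IH] Hf; have := Hf => -[cf df];
  split => //; try by move=> x Ux; exact: (continuousV (f0 x Ux) (cf x Ux)).
move=> i; have [df1 df2] := df i; split=> [x Ux|].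
  by apply: derivableV; [exact: f0|exact: df1].
have If := IH (CkS Hf).
apply: Ck_ext (CkM (CkM (Ck_cst r (-1)) (CkM If If)) df2) => x Ux.
rewrite mulN1r -expr2 exprVn.
exact/esym/(deriveV (f0 _ Ux) (df1 x Ux)).
Qed.

End CkCalculus.

(** * Points as components of the fixed point set *)

Section PointComponent.
Variables (R : realType) (n : nat) (M : closed_manifold R n) (x : M).

(** The image of a chart is open, hence it does not meet a plane of positive
    dimension in a single point. *)
Lemma submanifold_point p : submanifold p [set x] -> p = 0.
Proof.
move=> [pn /(_ x erefl)[c [[[_ [Q oQ QE] _ _ _] _] cx cE]]].
case: p pn cE => // p pn cE; exfalso.
have np : (0 < n)%N by case: n pn.
pose i0 : 'I_n := Ordinal np.
have Qx : Q (cmap c x).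
  by have [] : (Q `&` setT) (cmap c x) by rewrite -QE; exists x.
have xE : forall j : 'I_n, (p.+1 <= j)%N -> cmap c x 0 j = 0.
  by have [] : (cmap c @` cdom c `&` [set v | forall j : 'I_n, (p.+1 <= j)%N -> v 0 j = 0])
    (cmap c x) by rewrite -cE; exists x.
have : \forall t \near 0^'+, 0 < t /\ Q (cmap c x + t *: delta_mx 0 i0).
  near=> t; split; near: t; first exact: nbhs_right_gt.
  by apply: near_ray; exact: open_nbhs_nbhs.
move=> /filter_ex[t [t0 Qt]].
have [z [_ ->] /rowP/(_ i0)] :
    (cmap c @` (cdom c `&` [set x])) (cmap c x + t *: delta_mx 0 i0).
  rewrite cE; split; first by rewrite QE.
  move=> j pj; rewrite !mxE eqxx/= (_ : (j == i0) = false).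
    by rewrite mulr0 addr0 xE.
  by apply/negbTE; rewrite -val_eqE/= -lt0n (leq_trans _ pj).
rewrite !mxE !eqxx/=; lra.
Unshelve. all: by end_near. Qed.

Let smooth_point (f : M -> R) : smooth_fun [set x] f.
Proof.
move=> c ac y [z [cz zx] <-]; rewrite zx in cz *.
exists setT, (fun=> f (cinv c (cmap c x))); split => //; first exact: openT.
  by move=> r; apply: Ck_cst; exact: openT.
by move=> w [[w' [_ ->] <-] _].
Qed.

(** Every function is smooth on a point, in particular the function [h] that is 0
    at [x] and 1 elsewhere.  If [f] vanishes at [x], then [f = f * h], and the
    Leibniz rule gives [D f = 0]. *)
Lemma tangent_point D : tangent_vector [set x] x D <-> D = fun=> 0.
Proof.
split=> [[_ lin leib]|->]; last first.
  by split => // *; rewrite ?mulr0 ?mul0r ?addr0.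
have D1 : D (fun=> 1) = 0.
  have := leib _ _ (smooth_point (fun=> 1)) (smooth_point (fun=> 1)).
  rewrite (_ : (fun _ : M => 1 * 1) = fun=> 1); last first.
    by apply/funext => y; rewrite mulr1.
  by rewrite mul1r mulr1; lra.
have D0 f : f x = 0 -> D f = 0.
  move=> f0; pose h (y : M) : R := if y == x then 0 else 1.
  have := leib _ _ (smooth_point f) (smooth_point h).
  rewrite (_ : (fun y => f y * h y) = f).
    by rewrite f0 mul0r add0r /h eqxx mulr0.
  apply/funext => y; rewrite /h; case: eqP => [->|_]; last by rewrite mulr1.
  by rewrite f0 mul0r.
apply/funext => f.
have := lin (f x) (fun=> 1) (fun y => f y - f x) (smooth_point _) (smooth_point _).
rewrite D1 mulr0 add0r [X in _ = X]D0 ?subrr// => <-.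
by congr (D _); apply/funext => y; rewrite mulr1 addrC subrK.
Qed.

(** The tangent bundle is reduced to its zero section, whose Thom class is the
    constant cochain 1.  The squares of a cochain of degree 0 vanish in positive
    degree: in the sum that defines [Sq i], only [i = 1] and the empty set of cut
    vertices have the right cardinality, and then the only block has two
    vertices instead of one. *)
Lemma stiefel_whitney_point i : (0 < i)%N ->
  @stiefel_whitney R n M [set x] 0 i (fun=> 0).
Proof.
move=> i0.
have E0 : tangent_bundle [set x] `&` (@nonzero_vectors R n M) = set0.
  apply/seteqP; split => // e [[ex te]]; rewrite /nonzero_vectors/= => ne.
  by apply: ne; apply/tangent_point; move: te; rewrite ex.
have simp q (s : @stdsimplex R q -> tangent_ambient M) : ~ simplices set0 s.
  move=> [_ h]; pose v : 'rV[R]_q.+1 := delta_mx 0 ord0.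
  have vS : v \in @stdsimplex R q.
    apply/mem_set; split=> [j|]; first by rewrite mxE ler0n.
    rewrite (bigD1 ord0)//= big1 => [|j jn]; first by rewrite mxE !eqxx addr0.
    by rewrite mxE eqxx/= (negbTE jn).
  exact: (h (exist _ v vS)).
split.
  by split=> s _ //; rewrite /codiff big1.
exists (fun=> 1); last first.
  rewrite E0; case: i i0 => // i _; exists (fun=> 0); split => // s _.
  rewrite /codiff [RHS]big1// /cup mul0r sub0r /Sq big_pred0 ?oppr0//.
  move=> N; apply/negbTE/negP => /andP[/eqP N1 /eqP N2].
  have /eqP : (#|N| + i = 0)%N by move: N1; rewrite addnS => -[].
  rewrite addn_eq0 cards_eq0 => /andP[/eqP N0 _].
  have blocks0 : blocks N false = [set: _]%SET.
    apply/setP => v; rewrite /blocks N0 !inE.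
    rewrite (_ : [set _ | _]%SET = finset.set0) ?cards0//.
    by apply/setP => w; rewrite !inE.
  by move: N2; rewrite blocks0 cardsT card_ord.
split.
  rewrite E0; split=> s; last by move/simp.
  by move=> _; rewrite /codiff big_ord_recl big_ord1; apply/val_inj.
move=> _ -> /= cob.
have := cob (fun=> (x, fun=> 0)) => h.
have : (1 : 'F_2) = 0.
  apply: h; split; first exact: cst_continuous.
  by move=> t; split => //; split => //=; apply/tangent_point.
by move/eqP; rewrite oner_eq0.
Qed.

End PointComponent.

(** * The real projective space *)

Section ProjectiveSpace.
Variables (R : realType) (n : nat).
Local Notation V := 'rV[R]_n.+1.

Lemma cvg_mx (T : topologicalType) p q (F : T -> 'M[R]_(p, q)) (x : T) :
  (forall i j, {for x, continuous (fun y => F y i j)}) -> {for x, continuous F}.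
Proof.
move=> cF; apply/cvgrPdist_lt => eps eps0.
have : \forall y \near x, forall ij : 'I_p * 'I_q,
    `|F x ij.1 ij.2 - F y ij.1 ij.2| < eps.
  apply: (@filter_forall _ _ (fun (ij : 'I_p * 'I_q) y =>
    `|F x ij.1 ij.2 - F y ij.1 ij.2| < eps) (nbhs x)) => -[i j] /=.
  by have /cvgrPdist_lt := cF i j; apply.
apply: filterS => y Hy; rewrite [ltLHS]/Num.norm/= mx_normrE.
by apply/bigmax_ltP; split => // -[i j] _ /=; rewrite !mxE; exact: (Hy (i, j)).
Qed.

Definition sqnorm (w : V) : R := \sum_i w 0 i ^+ 2.
(** The orthogonal projection onto the line spanned by [w]. *)
Definition line_proj (w : V) : 'M[R]_n.+1 :=
  \matrix_(i, j) (w 0 i * w 0 j / sqnorm w).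

Lemma sqnorm_gt0 (w : V) : w != 0 -> 0 < sqnorm w.
Proof.
move=> /row_neq0[i wi].
rewrite /sqnorm (bigD1 i)//= ltr_pwDl ?sumr_ge0 ?exprn_even_gt0// => j _.
exact: sqr_ge0.
Qed.

Lemma line_projZ a (w : V) : a != 0 -> line_proj (a *: w) = line_proj w.
Proof.
move=> a0; have sE : sqnorm (a *: w) = a ^+ 2 * sqnorm w.
  by rewrite /sqnorm mulr_sumr; apply: eq_bigr => i _; rewrite mxE exprMn.
apply/matrixP => i j; rewrite !mxE sE invfM.
have -> : a * w 0 i * (a * w 0 j) * (a ^- 2 * (sqnorm w)^-1) =
  (a ^+ 2 * a ^- 2) * (w 0 i * w 0 j * (sqnorm w)^-1) by ring.
by rewrite divff ?mul1r// expf_neq0.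
Qed.

(** The real projective space, embedded in the space of matrices. *)
Definition proj_set : set 'M[R]_n.+1 := [set line_proj w | w in [set w | w != 0]].

Local Notation PS := (set_type proj_set : topologicalType).

Lemma line_proj_in (w : V) : w != 0 -> line_proj w \in proj_set.
Proof. by move=> w0; apply/mem_set; exists w. Qed.

Definition line (w : V) (w0 : w != 0) : PS :=
  exist (fun P => P \in proj_set) _ (line_proj_in w0).

Lemma lineP (x : PS) : exists2 w : V, w != 0 & set_val x = line_proj w.
Proof. by case: x => P /= /[dup] /set_mem[w w0 <-] ?; exists w. Qed.

Lemma set_val_cts (i j : 'I_n.+1) : continuous (fun x : PS => set_val x i j).
Proof.
move=> x; apply: (@continuous_comp _ _ _ (set_val : PS -> _) (fun P : 'M[R]_n.+1 => P i j)).
  exact: initial_continuous.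
exact: coord_continuous.
Qed.

Lemma sqnorm_cts : continuous sqnorm.
Proof.
apply: continuous_big => [|i _ w]; first exact: add_continuous.
apply: (@continuous_comp _ _ _ (fun w : V => w 0 i) (fun t : R => t ^+ 2)).
  exact: coord_continuous.
exact: exprn_continuous.
Qed.

Lemma line_proj_cts (w : V) : w != 0 -> {for w, continuous line_proj}.
Proof.
move=> w0; apply: cvg_mx => i j.
rewrite (_ : (fun y => _) = fun y : V => y 0 i * y 0 j / sqnorm y); last first.
  by apply/funext => y; rewrite mxE.
apply: continuousM; first by apply: continuousM; exact: coord_continuous.
apply: continuousV; first by rewrite gt_eqF// sqnorm_gt0.
exact: sqnorm_cts.
Qed.

Let e0 : V := delta_mx 0 ord0.
Let e0_neq0 : e0 != 0.
Proof. by apply/eqP => /rowP/(_ ord0); rewrite !mxE !eqxx => /eqP; rewrite oner_eq0. Qed.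

(** A continuous image of the unit sphere of the maximum norm. *)
Lemma proj_compact : compact [set: PS].
Proof.
(* [line] needs a nonzero vector; the junk value at 0 is off the sphere *)
pose nz (w : V) := if w == 0 then e0 else w.
have nzP w : nz w != 0 by rewrite /nz; case: ifP => [//|/negbT].
pose S := [set w : V | `|w| = 1].
have S0 w : S w -> w != 0.
  by move=> w1; rewrite -normr_eq0 w1 oner_eq0.
have cS : compact S.
  apply: bounded_closed_compact.
    exists 1; split; first exact: num_real.
    by move=> M M1 w /= ->; exact: ltW.
  apply: (@closed_comp _ _ (fun v : V => `|v|) [set t : R | t = 1]).
    by move=> v _; exact: norm_continuous.
  exact: closed_eq.
pose F w : PS := line (nzP w).
have cF : {within S, continuous F}.
  apply: (@continuous_comp_initial _ (subspace S) _ (set_val : PS -> _)).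
  apply: (@subspace_eq_continuous _ S _ line_proj).
    move=> w /set_mem/S0 w0; rewrite -[RHS]/(line_proj (nz w)).
    by rewrite /nz (negbTE w0).
  apply: continuous_in_subspaceT => w /set_mem/S0; exact: line_proj_cts.
suff -> : [set: PS] = F @` S by exact: continuous_compact.
apply/seteqP; split=> // x _; have [w w0 xw] := lineP x.
have nw : `|w| != 0 by rewrite normr_eq0.
have uS : S (`|w|^-1 *: w).
  by rewrite /S/= normZ normfV normr_id mulVf.
exists (`|w|^-1 *: w) => //; apply/val_inj; rewrite /= /nz (negbTE (S0 _ uS)).
by rewrite line_projZ ?invr_neq0// -xw.
Qed.

Lemma proj_hausdorff : hausdorff_space PS.
Proof.
rewrite open_hausdorff => x y xy.
have {}xy : set_val x != set_val y.
  by apply: contra xy => /eqP h; apply/eqP/val_inj.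
have := @norm_hausdorff _ 'M[R]_n.+1; rewrite open_hausdorff => /(_ _ _ xy).
move=> [[A B] /= [/set_mem xA /set_mem yB] [oA oB AB]].
have cv : continuous (set_val : PS -> 'M[R]_n.+1) by exact: initial_continuous.
exists (set_val @^-1` A, set_val @^-1` B) => /=; first by split; apply/mem_set.
split; [by apply: open_comp => // z _; exact: cv|
        by apply: open_comp => // z _; exact: cv|].
apply/eqP/seteqP; split=> // z [zA zB].
by have : (A `&` B) (set_val z) by []; rewrite (eqP AB).
Qed.

(** Homogeneous coordinates in the chart where the [i]-th one is normalized. *)
Definition hom (i : 'I_n.+1) (u : 'rV[R]_n) : V :=
  \row_j (if unlift i j is Some l then u 0 l else 1).

Lemma hom_i i u : hom i u 0 i = 1.
Proof. by rewrite mxE unlift_none. Qed.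

Lemma hom_lift i u l : hom i u 0 (lift i l) = u 0 l.
Proof. by rewrite mxE liftK. Qed.

Lemma hom_neq0 i u : hom i u != 0.
Proof.
by apply/eqP => /rowP/(_ i)/eqP; rewrite hom_i mxE oner_eq0.
Qed.

Definition proj_chart (i : 'I_n.+1) : chart R n PS :=
  @Chart R n PS [set x : PS | set_val x i i != 0]
    (fun x : PS => \row_l (set_val x i (lift i l) / set_val x i i))
    (fun u => line (hom_neq0 i u)).

Lemma proj_domP i (x : PS) (w : V) : w != 0 -> set_val x = line_proj w ->
  cdom (proj_chart i) x <-> w 0 i != 0.
Proof.
move=> w0 xw; rewrite /= xw mxE; have s0 := sqnorm_gt0 w0.
rewrite !mulf_eq0 invr_eq0 (gt_eqF s0) orbF orbb.
by [].
Qed.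

Lemma proj_mapE i (x : PS) (w : V) : w != 0 -> set_val x = line_proj w -> w 0 i != 0 ->
  cmap (proj_chart i) x = \row_l (w 0 (lift i l) / w 0 i).
Proof.
move=> w0 xw wi; have s0 := sqnorm_gt0 w0.
apply/rowP => l; rewrite !mxE xw !mxE; field.
by rewrite wi gt_eqF.
Qed.

Lemma hom_map i (w : V) : w 0 i != 0 ->
  hom i (\row_l (w 0 (lift i l) / w 0 i)) = (w 0 i)^-1 *: w.
Proof.
move=> wi; apply/rowP => j; rewrite !mxE.
case: unliftP => [l ->|->]; first by rewrite !mxE mulrC.
by rewrite mulVf.
Qed.

Lemma proj_mapK i (x : PS) : cdom (proj_chart i) x ->
  cinv (proj_chart i) (cmap (proj_chart i) x) = x.
Proof.
have [w w0 xw] := lineP x; move=> /(proj_domP _ w0 xw) wi.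
apply/val_inj; rewrite (proj_mapE w0 xw wi) /= (hom_map wi).
by rewrite line_projZ ?invr_neq0// -xw.
Qed.

Lemma proj_invK i u : cdom (proj_chart i) (cinv (proj_chart i) u) /\
  cmap (proj_chart i) (cinv (proj_chart i) u) = u.
Proof.
have h1 : hom i u 0 i != 0 by rewrite hom_i oner_eq0.
split; first exact/(@proj_domP i _ (hom i u) (hom_neq0 i u)).
rewrite (@proj_mapE i _ (hom i u) (hom_neq0 i u))//.
by apply/rowP => l; rewrite mxE hom_lift hom_i divr1.
Qed.

Lemma hom_cts i j : continuous (fun u => hom i u 0 j).
Proof.
rewrite (_ : (fun u => _) =
    fun u : 'rV[R]_n => if unlift i j is Some l then u 0 l else 1); last first.
  by apply/funext => v; rewrite mxE.
move=> u; case: (unlift i j) => [l|]; [exact: coord_continuous|exact: cst_continuous].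
Qed.

Lemma proj_is_chart i : is_chart setT (proj_chart i).
Proof.
split.
- apply: (@open_comp _ _ (fun x : PS => set_val x i i) [set t | t != 0]).
    by move=> x _; exact: set_val_cts.
  exact: open_neq.
- exists setT; first exact: openT.
  rewrite setIT; apply/seteqP; split => // u _.
  by have [? ?] := proj_invK i u; exists (cinv (proj_chart i) u).
- exact: proj_mapK.
- apply: continuous_in_subspaceT => x /set_mem xi; apply: cvg_mx => a l.
  rewrite (_ : (fun y => _) = fun y : PS => set_val y i (lift i l) / set_val y i i).
    apply: continuousM; first exact: set_val_cts.
    by apply: continuousV => //; exact: set_val_cts.
  by apply/funext => y; rewrite mxE.
- apply: continuous_subspaceT.
  apply: (@continuous_comp_initial _ _ _ (set_val : PS -> _)) => u.
  have -> : set_val \o cinv (proj_chart i) = line_proj \o hom i by apply/funext.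
  apply: continuous_comp; last exact: line_proj_cts (hom_neq0 i u).
  by apply: cvg_mx => a j; rewrite (ord1 a); exact: hom_cts.
Qed.

Definition sgn (t : 'F_2) : R := if t == 0 then 1 else -1.

Lemma sgnD s t : sgn (s + t) = sgn s * sgn t.
Proof.
have F2 (r : 'F_2) : r = 0 \/ r = 1.
  by case: r => -[|[|//]] h; [left|right]; apply/val_inj.
rewrite /sgn; have [->|->] := F2 s; have [->|->] := F2 t;
  rewrite ?addr0 ?add0r ?eqxx ?oner_eq0 ?mul1r ?mulr1//.
by rewrite (_ : 1 + 1 = 0 :> 'F_2) ?eqxx ?mulrNN ?mulr1//; apply/val_inj.
Qed.

Lemma sgn_neq0 t : sgn t != 0.
Proof. by rewrite /sgn; case: ifP; rewrite ?oppr_eq0 oner_eq0. Qed.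

Lemma sgn_sq t : sgn t * sgn t = 1.
Proof. by rewrite /sgn; case: ifP; rewrite ?mulrNN mulr1. Qed.

Local Notation G := 'rV['F_2]_n.+1.

(** All the sign changes of the homogeneous coordinates act; the simultaneous
    change of all the signs acts trivially on lines. *)
Definition flip (g : G) (w : V) : V := \row_j (sgn (g 0 j) * w 0 j).

Lemma flip_neq0 g w : w != 0 -> flip g w != 0.
Proof.
apply: contra_neq => /rowP h; apply/rowP => j; have := h j; rewrite !mxE => /eqP.
by rewrite mulf_eq0 (negbTE (sgn_neq0 _)) => /eqP.
Qed.

Lemma flip_proj g w :
  line_proj (flip g w) = \matrix_(i, j) (sgn (g 0 i) * sgn (g 0 j) * line_proj w i j).
Proof.
have sE : sqnorm (flip g w) = sqnorm w.
  by apply: eq_bigr => i _; rewrite mxE exprMn expr2 sgn_sq mul1r.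
by apply/matrixP => i j; rewrite !mxE sE; ring.
Qed.

Lemma proj_act_in (g : G) (x : PS) :
  \matrix_(i, j) (sgn (g 0 i) * sgn (g 0 j) * set_val x i j) \in proj_set.
Proof.
have [w w0 ->] := lineP x; rewrite -flip_proj; exact/line_proj_in/flip_neq0.
Qed.

Definition proj_act (g : G) (x : PS) : PS :=
  exist (fun P => P \in proj_set) _ (proj_act_in g x).

Lemma proj_actE g (x : PS) i j :
  set_val (proj_act g x) i j = sgn (g 0 i) * sgn (g 0 j) * set_val x i j.
Proof. by rewrite [LHS]mxE. Qed.

Lemma proj_act0 x : proj_act 0 x = x.
Proof.
apply/val_inj/matrixP => i j.
by rewrite [LHS]proj_actE !mxE /sgn eqxx !mul1r.
Qed.

Lemma proj_actD g h x : proj_act (g + h) x = proj_act g (proj_act h x).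
Proof.
apply/val_inj/matrixP => i j.
by rewrite [LHS]proj_actE [RHS]proj_actE proj_actE !mxE !sgnD; ring.
Qed.

Lemma proj_act_cts g : continuous (proj_act g).
Proof.
apply: (@continuous_comp_initial _ _ _ (set_val : PS -> _)) => x.
apply: cvg_mx => i j.
rewrite (_ : (fun y => _) = fun y : PS => sgn (g 0 i) * sgn (g 0 j) * set_val y i j).
  by apply: continuousM; [exact: cst_continuous|exact: set_val_cts].
by apply/funext => y; rewrite /= mxE.
Qed.

(** In charts, the action is given by quotients of homogeneous coordinates.  The
    element [0] of the group gives the transition maps. *)
Lemma proj_act_smooth g i j (D : set PS) : D `<=` cdom (proj_chart i) ->
  (forall x, D x -> cdom (proj_chart j) (proj_act g x)) ->
  smooth_on_vec (cmap (proj_chart i) @` D)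
    (cmap (proj_chart j) \o proj_act g \o cinv (proj_chart i)).
Proof.
move=> Di Dj l u [x Dx <-{u}].
pose U := [set u | hom i u 0 j != 0].
have oU : open U.
  apply: (@open_comp _ _ (fun u => hom i u 0 j) [set t | t != 0]).
    by move=> u _; exact: hom_cts.
  exact: open_neq.
have DU y : D y -> U (cmap (proj_chart i) y).
  move=> Dy; have [w w0 yw] := lineP y.
  have wi := (proj_domP _ w0 yw).1 (Di _ Dy).
  have wj : w 0 j != 0.
    have := Dj _ Dy; rewrite /= proj_actE yw mxE !mulf_eq0 !negb_or.
    by move=> /andP[_ /andP[/andP[]]].
  rewrite /U /mkset (proj_mapE w0 yw wi) (hom_map wi) mxE.
  by rewrite mulf_neq0// invr_eq0.
have homC r a : Ck r U (fun u => hom i u 0 a).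
  apply: (@Ck_ext _ _ _ oU _ (fun u : 'rV[R]_n => if unlift i a is Some l then u 0 l else 1)).
    by move=> u _; rewrite mxE.
  by case: (unlift i a) => [b|]; [exact: Ck_coord|exact: Ck_cst].
exists U, (fun u => sgn (g 0 j) * sgn (g 0 (lift j l)) *
  (hom i u 0 (lift j l) * (hom i u 0 j)^-1)).
split => //; first exact: DU.
  move=> r; apply: CkM => //; first exact: Ck_cst.
  by apply: CkM => //; apply: CkV.
move=> u [_ uU]; have s0 := sqnorm_gt0 (hom_neq0 i u).
rewrite /= mxE !proj_actE /= [line_proj _ _ _]mxE [X in _ / (_ * X)]mxE sgn_sq mul1r.
by field; rewrite uU gt_eqF.
Qed.

Definition proj_space : closed_manifold R n.
Proof.
apply: (@CompactManifold R n setT PS (range proj_chart) proj_hausdorff proj_compact).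
- by move=> _ [i _ <-]; exact: proj_is_chart.
- move=> x; have [w w0 xw] := lineP x.
  have [i wi] := row_neq0 w0.
  by exists (proj_chart i); [exists i|exact/(proj_domP _ w0 xw)].
- move=> _ _ [i _ <-] [j _ <-].
  have := @proj_act_smooth 0 i j (cdom (proj_chart i) `&` cdom (proj_chart j)).
  rewrite (_ : proj_act 0 = id); last by apply/funext => x; rewrite proj_act0.
  by apply => x [].
Defined.

Definition proj_action : smooth_action n.+1 proj_space.
Proof.
apply: (@SmoothAction R n.+1 n setT proj_space proj_act proj_act0 proj_actD) => g.
split; first exact/continuous_subspaceT/proj_act_cts.
move=> _ _ [i _ <-] [j _ <-]; apply: proj_act_smooth; first by move=> x [[]].
by move=> x [].
Defined.

Lemma delta_neq0 (i : 'I_n.+1) : (delta_mx 0 i : V) != 0.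
Proof.
by apply/eqP => /rowP/(_ i)/eqP; rewrite !mxE !eqxx oner_eq0.
Qed.

Definition vertex (i : 'I_n.+1) : proj_space := line (delta_neq0 i).

Lemma vertexE i a b : set_val (vertex i : PS) a b = ((a == i) && (b == i))%:R.
Proof.
have s1 : sqnorm (delta_mx 0 i) = 1.
  rewrite /sqnorm (bigD1 i)//= big1 => [|j ji].
    by rewrite mxE !eqxx expr1n addr0.
  by rewrite mxE (negbTE ji) andbF expr0n.
by rewrite /= !mxE s1 divr1 -natrM mulnb.
Qed.

Lemma sgn_delta (i j : 'I_n.+1) :
  sgn ((delta_mx 0 i : G) 0 j) = if j == i then -1 else 1.
Proof. by rewrite /sgn mxE eqxx/=; case: (j == i). Qed.

Lemma fixed_vertex (x : proj_space) :
  fixed proj_action x <-> exists i, x = vertex i.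
Proof.
split=> [fx|[i ->] g]; last first.
  apply/val_inj/matrixP => a b; rewrite [LHS]proj_actE !vertexE.
  by case: eqP => [->|_]; case: eqP => [->|_]; rewrite ?mulr0// sgn_sq mul1r.
have [w w0 xw] := lineP x.
have [i wi] := row_neq0 w0.
have s0 := sqnorm_gt0 w0.
exists i; apply/val_inj; rewrite [LHS]xw.
have wE : w = w 0 i *: delta_mx 0 i.
  apply/rowP => j; rewrite !mxE eqxx/=; have [->|ji] := eqVneq j i.
    by rewrite mulr1.
  rewrite mulr0; have := proj_actE (delta_mx 0 i) (x : PS) i j.
  have -> : proj_act (delta_mx 0 i) x = x by exact: fx.
  rewrite !sgn_delta eqxx (negbTE ji) mulr1 xw mxE => /eqP.
  rewrite -subr_eq0 mulN1r opprK -mulr2n mulrn_eq0/= !mulf_eq0 invr_eq0.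
  by rewrite (gt_eqF s0) orbF (negbTE wi) => /eqP.
by rewrite wE line_projZ.
Qed.

Lemma vertex_inj : injective vertex.
Proof.
move=> i j ij; have := vertexE i i i; rewrite ij vertexE eqxx.
by case: eqP => // _ /eqP; rewrite eq_sym oner_eq0.
Qed.

(** The entry [x i i] takes the value 1 at the vertex [i] and 0 at the
    others. *)
Lemma vertex_component i :
  connected_component (fixed_set proj_action) (vertex i) = [set vertex i].
Proof.
have half1 : 1 / 2 < 1 :> R by lra.
have half0 : 0 < 1 / 2 :> R by lra.
set C := connected_component _ _.
have Cx : C (vertex i).
  by apply: connected_component_refl; apply/fixed_vertex; exists i.
have CF y : C y -> exists j, y = vertex j.
  by move=> /connected_component_sub/fixed_vertex.
have cC : connected C by exact: component_connected.
have ci : continuous (fun x : PS => set_val x i i) by exact: set_val_cts.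
have val j : set_val (vertex j : PS) i i = (i == j)%:R by rewrite vertexE andbb.
have Bo : [set vertex i] = C `&` [set x : PS | 1 / 2 < set_val x i i].
  apply/seteqP; split=> [_ ->|y [/CF[j ->]] /=].
    by split => //=; rewrite val eqxx.
  by rewrite val; case: eqP => [->//|_]; rewrite ltNge (ltW half0).
have Bc : [set vertex i] = C `&` [set x : PS | 1 / 2 <= set_val x i i].
  apply/seteqP; split=> [_ ->|y [/CF[j ->]] /=].
    by split => //=; rewrite val eqxx ltW.
  by rewrite val; case: eqP => [->//|_]; rewrite leNgt half0.
apply/esym/cC; first by exists (vertex i).
  exists [set x : PS | 1 / 2 < set_val x i i] => //.
  apply: (@open_comp _ _ (fun x : PS => set_val x i i) [set t | 1 / 2 < t]).
    by move=> x _; exact: ci.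
  exact: open_gt.
exists [set x : PS | 1 / 2 <= set_val x i i] => //.
apply: (@closed_comp _ _ (fun x : PS => set_val x i i) [set t | 1 / 2 <= t]).
  by move=> x _; exact: ci.
exact: closed_ge.
Qed.

Lemma proj_component (C : set proj_space) :
  fixed_component proj_action C -> exists x, C = [set x].
Proof.
move=> [x /fixed_vertex[i ->] ->]; exists (vertex i); exact: vertex_component.
Qed.

(** In the chart centred at the vertex [i], the action is linear: it multiplies
    each affine coordinate by a sign, and each of them is changed by some sign
    change that preserves the [i]-th homogeneous coordinate. *)
Lemma vertex_nondegenerate i : nondegenerate proj_action (vertex i).
Proof.
pose S (g : G) : 'M[R]_n := diag_mx (\row_l (sgn (g 0 i) * sgn (g 0 (lift i l)))).
exists (proj_chart i), S; split.
- by exists i.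
- by rewrite /= vertexE eqxx oner_eq0.
- move=> g eps eps0; exists 1 => // y z _ _ _ _.
  have loc u : local_act proj_action (proj_chart i) g u = u *m S g.
    apply/rowP => l; rewrite mul_mx_diag [RHS]mxE [X in _ = _ * X]mxE.
    have s0 := sqnorm_gt0 (hom_neq0 i u).
    rewrite /local_act/= mxE !proj_actE /= [line_proj _ _ _]mxE
      [X in _ / (_ * X)]mxE hom_i hom_lift sgn_sq.
    by field; rewrite gt_eqF.
  by rewrite !loc mulmxBl subrr normr0 mulr_ge0// ltW.
move=> u uS; apply/rowP => l; have /rowP/(_ l) := uS (delta_mx 0 (lift i l)).
rewrite mul_mx_diag [LHS]mxE [X in _ * X = _]mxE !sgn_delta eqxx.
rewrite (negbTE (neq_lift i l)) mul1r mxE; lra.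
Qed.

End ProjectiveSpace.

Theorem mainTheorem3 (R : realType) :
  ~ (forall (k n : nat) (M : closed_manifold R n) (Phi : smooth_action k M),
       (0 < k)%N ->
       fixed_SW_trivial Phi ->
       (forall d : nat, fixed_dim Phi d -> (2 ^ k * d < n)%N) ->
       bounds_equivariantly Phi).
Proof.
move=> /(_ _ _ _ (proj_action R 2) isT); case.
- move=> C p /proj_component[x ->] /submanifold_point-> i i0.
  exact: stiefel_whitney_point.
- by move=> d [[C /proj_component[x ->] /submanifold_point->] _]; rewrite muln0.
move=> W [b [f [g [[sf sg] fB fK gK fE]]]].
have := @even_fixed_points R _ _ _ _ W b f g sf sg fB fK gK fE
  [seq vertex R i | i <- enum 'I_3].
rewrite size_map size_enum_ord => H; suff : ~~ odd 3 by [].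
apply: H.
- by rewrite map_inj_uniq ?enum_uniq//; exact: vertex_inj.
- move=> x; split=> [/mapP[i _ ->]|/fixed_vertex[i ->]].
    by apply/fixed_vertex; exists i.
  by apply: map_f; rewrite mem_enum.
- by move=> x /mapP[i _ ->]; exact: vertex_nondegenerate.
Qed.
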